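(* For any fixed variable $5$-line configuration, the number of its occurrences in a Steiner triple system of order $v$ can be computed in time $O(v^3)$.
   Context: A Steiner triple system of order $v$, STS$(v)$, is a pair $(V,\mathcal{B})$ with $|V|=v$ and $\mathcal{B}$ a set of 3-subsets (lines) of $V$ such that every 2-subset of $V$ lies in exactly one line. A configuration in it is a subset $\mathcal{B}'\subseteq\mathcal{B}$ together with the union of its lines as point set; an $n$-line configuration has $n$ lines. The number of occurrences of a configuration $C$ in an STS is the number of subsets $\mathcal{B}'\subseteq\mathcal{B}$ whose configuration is isomorphic to $C$. A configuration is constant if its number of occurrences in an STS$(v)$ depends only on $v$, and variable otherwise. The STS is the input. *)

(* Defs.v *)
From mathcomp Require Import all_boot.
Set Implicit Arguments.
Unset Strict Implicit.
Unset Printing Implicit Defensive.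

Definition steiner_triple_system (V : finType) (B : {set {set V}}) : Prop :=
  (forall l, l \in B -> #|l| = 3) /\
  (forall e : {set V}, #|e| = 2 -> exists! l, l \in B /\ e \subset l).

(* A configuration is given by its set of lines [C]; its points are
   [cover C], so elements of the ground type lying on no line play no role. *)
Definition configuration (V : finType) (C : {set {set V}}) : Prop :=
  exists B : {set {set V}}, steiner_triple_system B /\ C \subset B.

Definition config_iso (V W : finType)
    (C : {set {set V}}) (D : {set {set W}}) : bool :=
  [exists f : {ffun V -> W},
     dinjectiveb f (cover C) && ([set f @: (l : {set V}) | l in C] == D)].

Definition occurrences (V W : finType)
    (C : {set {set V}}) (B : {set {set W}}) : nat :=
  #|[set D : {set {set W}} | (D \subset B) && config_iso C D]|.

Definition constant_configuration (V : finType) (C : {set {set V}}) : Prop :=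
  exists f : nat -> nat,
    forall (W : finType) (B : {set {set W}}),
      steiner_triple_system B -> occurrences C B = f #|W|.

Definition variable_configuration (V : finType) (C : {set {set V}}) : Prop :=
  ~ constant_configuration C.

(* Running time is measured on a word RAM: every instruction has unit cost,
   and every word has O(log v) bits on inputs of order v (see
   [computable_in_time] below). [Jlt a b t] jumps to instruction t when
   register a < register b; the machine halts when its program counter
   leaves the program. Subtraction is truncated and n / 0 = 0. *)
Inductive instr : Type :=
| Const of nat & nat
| Add of nat & nat & nat
| Sub of nat & nat & nat
| Mul of nat & nat & nat
| Div of nat & nat & nat
| Read of nat & nat
| Write of nat & nat
| Jlt of nat & nat & nat.

Definition program : Type := seq instr.

Record state : Type := State {
  pc : nat;
  regs : nat -> nat;
  mem_cells : nat -> nat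
}.

Definition update (f : nat -> nat) (i x : nat) : nat -> nat :=
  fun j => if j == i then x else f j.

Definition exec (c : instr) (s : state) : state :=
  let r := regs s in
  let m := mem_cells s in
  let set_reg d x := State (pc s).+1 (update r d x) m in
  match c with
  | Const d n => set_reg d n
  | Add d a b => set_reg d (r a + r b)
  | Sub d a b => set_reg d (r a - r b)
  | Mul d a b => set_reg d (r a * r b)
  | Div d a b => set_reg d (r a %/ r b)
  | Read d a => set_reg d (m (r a))
  | Write a b => State (pc s).+1 r (update m (r a) (r b))
  | Jlt a b t => State (if r a < r b then t else (pc s).+1) r m
  end.

Definition step (p : program) (s : state) : state :=
  if onth p (pc s) is Some c then exec c s else s.

Definition halted (p : program) (s : state) : Prop := size p <= pc s.

Definition words_below (bound : nat) (s : state) : Prop :=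
  (forall i, regs s i < bound) /\ (forall i, mem_cells s i < bound).

Definition lists_lines (v : nat)
    (s : seq ('I_v * 'I_v * 'I_v)) (B : {set {set 'I_v}}) : Prop :=
  perm_eq [seq [set x.1.1; x.1.2; x.2] | x <- s] (enum B).

(* Input: register 0 holds v, register 1 the number of lines, and the memory
   cells 3i, 3i+1, 3i+2 hold the three points of the i-th line. All other
   registers and cells are 0. *)
Definition initial_state (v : nat) (s : seq ('I_v * 'I_v * 'I_v)) : state :=
  State 0
    (fun i => nth 0 [:: v; size s] i)
    (fun i => nth 0
       (flatten [seq [:: val x.1.1; val x.1.2; val x.2] | x <- s]) i).

Definition bigO (f g : nat -> nat) : Prop :=
  exists c n0 : nat, forall n, n0 <= n -> f n <= c * g n.

(* One program works for all orders v, all systems on the points 0..v-1, and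
   all orders in which the lines, and the points of each line, may be listed.
   The bound (v+2)^k says that words have O(log v) bits. The result is left in
   register 0. *)
Definition computable_in_time
    (F : forall v : nat, {set {set 'I_v}} -> nat) (g : nat -> nat) : Prop :=
  exists (p : program) (k : nat) (time : nat -> nat),
    bigO time g /\
    forall (v : nat) (B : {set {set 'I_v}}) (s : seq ('I_v * 'I_v * 'I_v)),
      steiner_triple_system B -> lists_lines s B ->
      exists n : nat,
        [/\ n <= time v,
            halted p (iter n (step p) (initial_state s)),
            regs (iter n (step p) (initial_state s)) 0 = F v B
          & forall m, m <= n ->
              words_below (v.+2 ^ k) (iter m (step p) (initial_state s))].

(* Main.v *)
Require Import Defs.
From mathcomp Require Import all_boot zify.
Set Implicit Arguments.
Unset Strict Implicit.
Unset Printing Implicit Defensive.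

(** A Steiner triple system is the same thing as an idempotent commutative
    quasigroup with x(xy) = y.  A copy of a configuration C is a solution of the
    system of equations ab = c, one per line of C, whose points are pairwise
    distinct.  Disequalities are removed by inclusion-exclusion, equalities by
    substitution, and a point lying on a single line is determined by the other
    two, so that its line can be dropped.  With at most five lines the only
    systems that cannot be simplified this way are the empty one, the Pasch
    configuration and the mitre.  Hence the number of copies is, up to division
    by a constant and a power of v, a fixed polynomial in v and in the numbers
    of triples (a, b, d) with (ab)(ad) = bd and with (ab)(ad) = a(bd).  A RAM
    that has tabulated the product counts these triples in O(v^3) steps. *)

(** * Steiner quasigroups and polynomially determined counts *)

(** Substitution is what shapes the argument. Identifying two points may collapse a line or give two
    lines two common points, so the systems that arise are more general than configurations. Every
    such degeneracy is again an equality between two points, with one line fewer; the reductions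
    therefore terminate for the lexicographic order on the number of lines, then the number of
    equalities.

    Five lines are within reach because a line of a system that admits no reduction forces three
    further lines, one through each of its points. At most one line is then left over, and if there
    is one, the odd number 15 of incidences produces a point on three lines, which leaves no
    freedom.

    All counts are of maps on one fixed finite type. Eliminating a point frees its coordinate
    instead of deleting it, which multiplies the count by v; this is where the power of v comes
    from. The constant divisor is the number of automorphisms of the configuration. *)

Definition squag (W : eqType) (op : W -> W -> W) : Prop :=
  [/\ forall x, op x x = x, commutative op & forall x y, op x (op x y) = y].

(** With commutativity this makes the relation xy = z totally symmetric, so a line equation may be
    solved for any of its points. *)
Lemma squag_swap (W : eqType) (op : W -> W -> W) x y z :
  squag op -> (op x y == z) = (op x z == y).
Proof. by case=> _ _ K; apply/eqP/eqP => <-. Qed.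

Definition line_op (W : finType) (B : {set {set W}}) (x y : W) : W :=
  if x == y then x else
    odflt x [pick z | [&& z != x, z != y & [set x; y; z] \in B]].

Lemma set3_rot (W : finType) (x y z : W) : [set x; y; z] = [set y; z; x].
Proof. by apply/setP=> t; rewrite !inE; do 3!case: eqP. Qed.

Lemma set3_swap (W : finType) (x y z : W) : [set x; y; z] = [set y; x; z].
Proof. by apply/setP=> t; rewrite !inE; do 3!case: eqP. Qed.

Section LineOp.

Variables (W : finType) (B : {set {set W}}).
Hypothesis sts : steiner_triple_system B.

Lemma line_opE x y z : x != y ->
  (line_op B x y == z) = [&& z != x, z != y & [set x; y; z] \in B].
Proof.
have [B3 B2] := sts; move=> nxy.
have [l [[lB sl] ul]] := B2 [set x; y] (etrans (cards2 x y) (congr1 S (congr1 nat_of_bool nxy))).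
have [w lE] : exists w, l :\: [set x; y] = [set w].
  apply/cards1P; rewrite cardsD (setIidPr sl) (B3 _ lB) cards2 nxy //.
have wl : w \in l :\: [set x; y] by rewrite lE set11.
have lE' : l = [set x; y; w].
  by rewrite -{1}(setID l [set x; y]) (setIidPr sl) lE.
move: wl; rewrite !inE negb_or => /andP[/andP[wx wy] _].
have uw t : [&& t != x, t != y & [set x; y; t] \in B] = (t == w).
  apply/and3P/eqP => [[tx ty tB]|->]; last by rewrite wx wy -lE'.
  have : t \in l.
    rewrite (ul [set x; y; t]) ?inE ?eqxx ?orbT //; split=> //.
    by apply/subsetP=> u; rewrite !inE => ->.
  by rewrite lE' !inE (negPf tx) (negPf ty) => /eqP.
rewrite /line_op (negPf nxy) uw; case: pickP => [t|/(_ w)].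
  by rewrite uw => /eqP ->; rewrite eq_sym.
by rewrite uw eqxx.
Qed.

Lemma line_op_squag : squag (line_op B).
Proof.
have id_op x : line_op B x x = x by rewrite /line_op eqxx.
have opC : commutative (line_op B).
  move=> x y; have [->//|nxy] := eqVneq x y.
  apply/eqP; rewrite line_opE //.
  have := eqxx (line_op B y x); rewrite line_opE 1?eq_sym // => /and3P[-> ->].
  by rewrite set3_swap.
split=> // x y; have [<-|nxy] := eqVneq x y; first by rewrite !id_op.
have := eqxx (line_op B x y); rewrite line_opE // => /and3P[zx zy zB].
apply/eqP; rewrite line_opE 1?eq_sym // nxy (eq_sym y) zy /=.
by rewrite set3_swap set3_rot.
Qed.

End LineOp.

(** Polynomials are kept as syntax because the same object is evaluated in the counting arguments
    and compiled to machine code. *)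
Inductive expr : Type :=
| Cst of nat
| Order
| Paschs
| Mitres
| Plus of expr & expr
| Times of expr & expr.

Fixpoint eval (v P M : nat) (e : expr) : nat :=
  match e with
  | Cst n => n
  | Order => v
  | Paschs => P
  | Mitres => M
  | Plus e1 e2 => eval v P M e1 + eval v P M e2
  | Times e1 e2 => eval v P M e1 * eval v P M e2
  end.

Fixpoint Power (e : expr) (n : nat) : expr :=
  if n is n'.+1 then Times e (Power e n') else Cst 1.

Lemma eval_Power v P M e n : eval v P M (Power e n) = eval v P M e ^ n.
Proof. by elim: n => //= n ->; rewrite expnS. Qed.

(** With c = ab, e = ad and f = bd this says ce = f: the lines abc, ade, bdf, cef form a Pasch
    configuration, or a degenerate image of one. *)
Definition pasch_eq (W : eqType) (op : W -> W -> W) (a b d : W) : bool :=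
  op (op a b) (op a d) == op b d.

(** Left self-distributivity at a, b, d. With c = ab, e = ad, f = bd and g = af it says ce = g: a
    mitre with lines abc, ade, afg, bdf, ceg, or a degenerate image of one. *)
Definition mitre_eq (W : eqType) (op : W -> W -> W) (a b d : W) : bool :=
  op (op a b) (op a d) == op a (op b d).

Definition count3 (W : finType) (Q : W -> W -> W -> bool) : nat :=
  #|[set t : W * W * W | Q t.1.1 t.1.2 t.2]|.

(** The identity F = (p - q) / v^K, with subtraction and division cleared so that it makes sense
    over the natural numbers and for v = 0. The witnesses are uniform in v and in the quasigroup. *)
Definition good (F : forall v : nat, ('I_v -> 'I_v -> 'I_v) -> nat) : Prop :=
  exists K p q, forall v (op : 'I_v -> 'I_v -> 'I_v), squag op ->
    let ev := eval v (count3 (pasch_eq op)) (count3 (mitre_eq op)) in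
    v ^ K * F v op + ev q = ev p.

Lemma eq_good (F G : forall v : nat, ('I_v -> 'I_v -> 'I_v) -> nat) :
  (forall v op, squag op -> F v op = G v op) -> good F -> good G.
Proof.
by move=> FG [K [p [q H]]]; exists K, p, q => v op sq; rewrite -FG //; apply: H.
Qed.

Lemma good_eval e :
  good (fun v op => eval v (count3 (pasch_eq op)) (count3 (mitre_eq op)) e).
Proof. by exists 0, e, (Cst 0) => v op _ /=; rewrite mul1n addn0. Qed.

(** Each identity is multiplied by the denominator of the other, and the two sides of the one for
    [G] are exchanged to subtract it. *)
Lemma good_sub (F G : forall v : nat, ('I_v -> 'I_v -> 'I_v) -> nat) :
  good G -> good (fun v op => F v op + G v op) -> good F.
Proof.
move=> [K [p [q H]]] [K' [p' [q' H']]].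
exists (K + K'), (Plus (Times (Power Order K) p') (Times (Power Order K') q)).
exists (Plus (Times (Power Order K) q') (Times (Power Order K') p)).
move=> v op sq /=; rewrite !eval_Power /= -H // -H' // expnD; nia.
Qed.

Lemma good_divX n (F : forall v : nat, ('I_v -> 'I_v -> 'I_v) -> nat) :
  good (fun v op => F v op * v ^ n) -> good F.
Proof.
move=> [K [p [q H]]]; exists (K + n), p, q => v op sq /=.
by rewrite -H // expnD -mulnA (mulnC (F v op)).
Qed.

(** * Counting maps with a determined coordinate *)

Section Update.

Variables (X W : finType).
Implicit Types (f : {ffun X -> W}) (c : X).

Definition set_at f c w : {ffun X -> W} := [ffun x => if x == c then w else f x].

Lemma set_at_eq f c w : set_at f c w c = w.
Proof. by rewrite ffunE eqxx. Qed.

Lemma set_at_neq f c w x : x != c -> set_at f c w x = f x.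
Proof. by rewrite ffunE => /negPf ->. Qed.

Lemma set_at_twice f c w w' : set_at (set_at f c w) c w' = set_at f c w'.
Proof. by apply/ffunP=> x; rewrite !ffunE; case: eqP. Qed.

Lemma set_at_id f c : set_at f c (f c) = f.
Proof. by apply/ffunP=> x; rewrite !ffunE; case: eqP => // ->. Qed.

(** Overwriting the value at [c] is a bijection from pairs (constrained map, element of [W]) onto
    the maps satisfying [Q]; its inverse resets that value to [g f], which is well defined because
    neither [Q] nor [g] sees the coordinate [c]. *)
Lemma card_determined c (Q : pred {ffun X -> W}) (g : {ffun X -> W} -> W) :
  (forall f w, Q (set_at f c w) = Q f) ->
  (forall f w, g (set_at f c w) = g f) ->
  #|[set f : {ffun X -> W} | (f c == g f) && Q f]| * #|W| =
  #|[set f : {ffun X -> W} | Q f]|.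
Proof.
move=> Qc gc; rewrite -cardsT -cardsX.
have -> : [set f | Q f] =
    [set set_at p.1 c p.2 | p in setX [set f : {ffun X -> W} | (f c == g f) && Q f] setT].
  apply/setP=> f; rewrite inE; apply/idP/imsetP => [Qf|[[h w]]].
    exists (set_at f c (g f), f c); last by rewrite /= set_at_twice set_at_id.
    by rewrite !inE /= set_at_eq gc Qc eqxx Qf.
  by rewrite !inE => /andP[/andP[_ Qh] _] ->; rewrite Qc.
rewrite card_in_imset // => -[f w] [h u]; rewrite !inE /=.
move=> /andP[/andP[/eqP fc _] _] /andP[/andP[/eqP hc _] _] E.
have gE : g f = g h by rewrite -(gc f w) E gc.
have <- : w = u by rewrite -(set_at_eq f c w) E set_at_eq.
congr (_, _); rewrite -(set_at_id f c) -(set_at_id h c) fc hc gE.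
by rewrite -(set_at_twice f c w) E set_at_twice.
Qed.

(** The fibres of f -> (f a, f b, f c) all have the same size: fixing each of the three values is a
    determined coordinate. The factor |W|^3 avoids a subtraction in the exponent. *)
Lemma card_determined3 a b c (Q : W -> W -> W -> bool) : uniq [:: a; b; c] ->
  #|[set f : {ffun X -> W} | Q (f a) (f b) (f c)]| * #|W| ^ 3 =
  #|W| ^ #|X| * count3 Q.
Proof.
rewrite /= !inE negb_or => /andP[/andP[ab ac] /andP[bc _]].
have fib x y z : #|[set f : {ffun X -> W} |
    [&& f a == x, f b == y & f c == z]]| * #|W| ^ 3 = #|W| ^ #|X|.
  rewrite 2!expnS expn1 !mulnA.
  rewrite card_determined => [|f w|] //; last by rewrite !set_at_neq // eq_sym.
  rewrite card_determined => [|f w|] //; last by rewrite !set_at_neq // eq_sym.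
  have := @card_determined c xpredT (fun _ => z) (fun _ _ => erefl) (fun _ _ => erefl).
  under eq_finset do rewrite andbT.
  by move=> ->; rewrite -card_ffun; apply: eq_card => f; rewrite !inE.
pose h (f : {ffun X -> W}) := (f a, f b, f c).
rewrite -[#|[set f | _]|]sum1_card
  (partition_big h (fun t => t \in [set t | Q t.1.1 t.1.2 t.2])) /=; last first.
  by move=> f; rewrite !inE.
rewrite big_distrl /= mulnC -sum_nat_const.
apply: eq_bigr => -[[x y] z]; rewrite inE /= => Qt; rewrite -(fib x y z).
congr (_ * _); rewrite -sum1_card; apply: eq_bigl => f; rewrite !inE /h !xpair_eqE -andbA.
by apply/andP/idP => [[]//|E]; split=> //; case/and3P: E => /eqP-> /eqP-> /eqP->.
Qed.

End Update.

Lemma good_determined (X : finType) (c : X)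
    (g : forall v, ('I_v -> 'I_v -> 'I_v) -> {ffun X -> 'I_v} -> 'I_v)
    (Q Q' : forall v, ('I_v -> 'I_v -> 'I_v) -> pred {ffun X -> 'I_v}) :
  (forall v op f, squag op -> Q' v op f = (f c == g v op f) && Q v op f) ->
  (forall v op f w, Q v op (set_at f c w) = Q v op f) ->
  (forall v op f w, g v op (set_at f c w) = g v op f) ->
  good (fun v op => #|[set f | Q v op f]|) ->
  good (fun v op => #|[set f | Q' v op f]|).
Proof.
move=> Q'E Qc gc G; apply: (@good_divX 1); apply: eq_good G => v op sq.
have := @card_determined X 'I_v c (Q v op) (g v op) (Qc v op) (gc v op).
rewrite card_ord expn1 => <-; congr (_ * _); apply: eq_card => f.
by rewrite !inE Q'E.
Qed.

Lemma good_count3 (X : finType) (a b d : X) (e : expr)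
    (Q : forall v, ('I_v -> 'I_v -> 'I_v) -> 'I_v -> 'I_v -> 'I_v -> bool) :
  uniq [:: a; b; d] ->
  (forall v op, count3 (Q v op) =
     eval v (count3 (pasch_eq op)) (count3 (mitre_eq op)) e) ->
  good (fun v op => #|[set f : {ffun X -> 'I_v} | Q v op (f a) (f b) (f d)]|).
Proof.
move=> U QE; apply: (@good_divX 3).
apply: eq_good (good_eval (Times (Power Order #|X|) e)) => v op sq.
have := @card_determined3 X 'I_v a b d (Q v op) U; rewrite card_ord => ->.
by rewrite /= eval_Power /= -QE.
Qed.

(** * Systems of line equations *)

Section Systems.

Variable X : finType.
Implicit Types (E : seq (X * X)) (l : seq X) (L : seq (seq X)).

Definition sat_eq (W : eqType) (f : X -> W) (e : X * X) : bool := f e.1 == f e.2.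

(** Lines are sequences rather than sets because a substitution may repeat a point; an equation such
    as aa = c still has a meaning in the quasigroup. *)
Definition sat (W : eqType) (op : W -> W -> W) (f : X -> W) (l : seq X) : bool :=
  if l is [:: a; b; c] then op (f a) (f b) == f c else true.

Definition solutions E D L v (op : 'I_v -> 'I_v -> 'I_v) : nat :=
  #|[set f : {ffun X -> 'I_v} |
      [&& all (sat_eq f) E, all (predC (sat_eq f)) D & all (sat op f) L]]|.

(* Equality up to the order of the lines and of the points on each line. *)
Definition eqv L L' : Prop :=
  forall p : pred (seq X), (forall l l', perm_eq l l' -> p l = p l') ->
    count p L = count p L'.

Lemma eqv_trans L1 L2 L3 : eqv L1 L2 -> eqv L2 L3 -> eqv L1 L3.
Proof. by move=> H1 H2 p pP; rewrite (H1 p pP); apply: H2. Qed.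

Lemma eqv_perm L L' : perm_eq L L' -> eqv L L'.
Proof. by move=> /permP H p _; apply: H. Qed.

Lemma eqv_cat L1 L2 L : eqv L1 L2 -> eqv (L ++ L1) (L ++ L2).
Proof. by move=> H p pP; rewrite !count_cat (H p pP). Qed.

Lemma eqv_line l l' L : perm_eq l l' -> eqv (l :: L) (l' :: L).
Proof. by move=> H p pP /=; rewrite (pP _ _ H). Qed.

Lemma eqv_size L L' : eqv L L' -> size L = size L'.
Proof. by move=> H; rewrite -!count_predT; apply: H. Qed.

Lemma perm3P (T : eqType) (l : seq T) x y z : perm_eq l [:: x; y; z] ->
  [\/ [\/ l = [:: x; y; z] | l = [:: x; z; y]],
      [\/ l = [:: y; x; z] | l = [:: y; z; x]] |
      [\/ l = [:: z; x; y] | l = [:: z; y; x]]].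
Proof.
have P2 b c u w : perm_eq [:: b; c] [:: u; w] ->
    [:: b; c] = [:: u; w] :> seq T \/ [:: b; c] = [:: w; u].
  move=> H; have := perm_mem H b; rewrite !inE eqxx /= => /esym/orP[]/eqP E; subst b.
    by left; move: H; rewrite perm_cons => /perm_small_eq->.
  right; move: H; rewrite perm_sym (perm_catC [:: u] [:: w]) perm_sym perm_cons.
  by move=> /perm_small_eq->.
move=> H; case: l H (perm_size H) => [|a [|b [|c []]]] // H _.
have := perm_mem H a; rewrite !inE eqxx /= => /esym/or3P[]/eqP E; subst a.
- by move: H; rewrite perm_cons => /P2[] [-> ->]; apply: Or31; [left|right].
- move: H; rewrite perm_sym (perm_catCA [:: x] [:: y] [:: z]) perm_sym perm_cons.
  by move=> /P2[] [-> ->]; apply: Or32; [left|right].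
move: H; rewrite perm_sym (perm_catC [:: x; y] [:: z]) perm_sym perm_cons.
by move=> /P2[] [-> ->]; apply: Or33; [left|right].
Qed.

Lemma sat_perm (W : eqType) (op : W -> W -> W) (f : X -> W) l l' :
  squag op -> perm_eq l l' -> sat op f l = sat op f l'.
Proof.
move=> sq H; have := perm_size H.
case: l' H => [|x [|y [|z [|t r]]]] H; case: (l) H => [|a [|b [|c [|d s]]]] // H _.
have sw := squag_swap _ _ _ sq; case: (sq) => _ C _.
case: (perm3P H) => [] [] [-> -> ->] //=.
- by rewrite C sw C.
- by rewrite sw C.
- by rewrite C sw.
by rewrite sw C sw.
Qed.

Lemma all_sat_eqv (W : eqType) (op : W -> W -> W) (f : X -> W) L L' :
  squag op -> eqv L L' -> all (sat op f) L = all (sat op f) L'.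
Proof.
move=> sq H; rewrite !all_count (eqv_size H) H // => l l'.
exact: sat_perm.
Qed.

Definition wf L : bool := all (fun l => size l == 3) L.

Lemma wf_eqv L L' : eqv L L' -> wf L -> wf L'.
Proof.
move=> H; rewrite /wf !all_count (eqv_size H) H //.
by move=> l l' /perm_size ->.
Qed.

Definition through x (l : seq X) : bool := x \in l.
Definition through2 x y (l : seq X) : bool := (x \in l) && (y \in l).

Lemma through_perm x l l' : perm_eq l l' -> through x l = through x l'.
Proof. by move=> /perm_mem H; apply: H. Qed.

Lemma through2_perm x y l l' : perm_eq l l' -> through2 x y l = through2 x y l'.
Proof. by move=> /perm_mem H; rewrite /through2 !H. Qed.

(** Each clause blocks one reduction: a line with a repeated point is an equality, a point on a
    single line is determined, and two lines with two common points force their third points to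
    agree. *)
Definition irreducible L : Prop :=
  [/\ all uniq L, forall x, count (through x) L != 1
    & forall x y, x != y -> count (through2 x y) L <= 1].

Lemma irreducible_eqv L L' : eqv L L' -> irreducible L -> irreducible L'.
Proof.
move=> H [U D1 D2]; split.
- move: U; rewrite !all_count (eqv_size H) H // => l l' /perm_uniq; exact.
- by move=> x; rewrite -H //; apply: through_perm.
by move=> x y xy; rewrite -H; [apply: D2 | apply: through2_perm].
Qed.

Lemma eqv_mem l L : l \in L -> eqv L (l :: rem l L).
Proof. by move=> lL; apply/eqv_perm/perm_to_rem. Qed.

Lemma perm_front3 l x : size l == 3 -> x \in l -> exists y z, perm_eq l [:: x; y; z].
Proof.
move=> s3 /perm_to_rem H; have := perm_size H; move/eqP: s3 => -> /=.
by case: (rem x l) H => [|y [|z []]] // H _; exists y, z.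
Qed.

Lemma perm_front3_2 l x y : size l == 3 -> x != y -> x \in l -> y \in l ->
  exists z, perm_eq l [:: x; y; z].
Proof.
move=> s3 xy xl; have [a [b H]] := perm_front3 s3 xl.
rewrite (perm_mem H) !inE eq_sym (negPf xy) /= => /orP[]/eqP E; subst y.
  by exists b.
by exists a; apply: (perm_trans H); rewrite perm_cons (perm_catC [:: a] [:: b]).
Qed.

Lemma pull L x : wf L -> 0 < count (through x) L ->
  exists y z L', eqv L ([:: x; y; z] :: L').
Proof.
move=> wL; rewrite -has_count => /hasP[l lL xl].
have [y [z H]] := perm_front3 (allP wL l lL) xl.
by exists y, z, (rem l L); apply: (eqv_trans (eqv_mem lL)); apply: eqv_line.
Qed.

Lemma pull2 L x y : wf L -> x != y -> 0 < count (through2 x y) L ->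
  exists z L', eqv L ([:: x; y; z] :: L').
Proof.
move=> wL xy; rewrite -has_count => /hasP[l lL /andP[xl yl]].
have [z H] := perm_front3_2 (allP wL l lL) xy xl yl.
by exists z, (rem l L); apply: (eqv_trans (eqv_mem lL)); apply: eqv_line.
Qed.

Lemma good_solutions_eqv E L L' :
  eqv L L' -> good (solutions E [::] L') -> good (solutions E [::] L).
Proof.
move=> H; apply: eq_good => v op sq; apply: eq_card => f.
by rewrite !inE (all_sat_eqv f sq H).
Qed.

Lemma sat_set_at v (op : 'I_v -> 'I_v -> 'I_v) (f : {ffun X -> 'I_v}) c w l :
  c \notin l -> sat op (set_at f c w) l = sat op f l.
Proof.
case: l => [|x [|y [|z []]]] //=; rewrite !inE !negb_or => /and3P[xc yc zc].
by rewrite !set_at_neq 1?eq_sym.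
Qed.

Lemma all_sat_set_at v (op : 'I_v -> 'I_v -> 'I_v) (f : {ffun X -> 'I_v}) c w L :
  count (through c) L = 0 -> all (sat op (set_at f c w)) L = all (sat op f) L.
Proof.
move/eqP; rewrite -leqn0 leqNgt -has_count => /hasPn H.
by apply: eq_in_all => l lL; apply: sat_set_at; apply: H.
Qed.

(** Given the other lines, [l] only says that two points have the same image, so it is traded for an
    equality and the number of lines drops. *)
Lemma good_eq_line E L x y l : wf L ->
  (forall E L', wf L' -> size L' <= size L -> good (solutions E [::] L')) ->
  (forall v (op : 'I_v -> 'I_v -> 'I_v) (f : {ffun X -> 'I_v}), squag op ->
     all (sat op f) L -> sat op f l = (f x == f y)) ->
  good (solutions E [::] (l :: L)).
Proof.
move=> wL IH H; apply: eq_good (IH ((x, y) :: E) L wL (leqnn _)) => v op sq.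
apply: eq_card => f; rewrite !inE /= {1}/sat_eq /=.
case sL: (all (sat op f) L); rewrite ?andbF // (H v) // !andbT.
exact: andbC.
Qed.

Lemma irreducible_or_good L : wf L ->
  (forall E L', wf L' -> size L' < size L -> good (solutions E [::] L')) ->
  irreducible L \/ good (solutions [::] [::] L).
Proof.
move=> wL IH.
have [U|/allPn[l lL nu]] := boolP (all uniq L); last first.
  right; apply: (good_solutions_eqv (eqv_mem lL)).
  have sL := perm_size (perm_to_rem lL); rewrite /= in sL.
  have := wf_eqv (eqv_mem lL) wL; rewrite /wf /= => /andP[s3 wL'].
  have IH' E L' : wf L' -> size L' <= size (rem l L) -> good (solutions E [::] L').
    by move=> *; apply: IH; rewrite // sL ltnS.
  case: l lL nu s3 sL wL' IH' => [|a [|b [|c []]]] //= lL nu _ sL wL' IH'.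
  (* Whichever two points of the line coincide, idempotence forces the third to have the same
     image. *)
  move: nu; rewrite negb_and andbT !negbK !inE -orbA => /or3P[]/eqP E; subst.
  - apply: (@good_eq_line [::] _ b c _ wL' IH') => v op f [I _ _] _ /=.
    by rewrite I.
  - apply: (@good_eq_line [::] _ c b _ wL' IH') => v op f sq _ /=.
    by rewrite squag_swap //; case: sq => ->.
  apply: (@good_eq_line [::] _ c a _ wL' IH') => v op f sq _ /=.
  by case: (sq) => I C _; rewrite C squag_swap // I.
have [/existsP[x /eqP x1]|/existsPn D1] := boolP [exists x, count (through x) L == 1].
  right; have [] := @pull L x wL; first by rewrite x1.
  move=> y [z [L' eL]]; apply: (good_solutions_eqv eL).
  have x0 : count (through x) L' = 0.
    by move: (eL _ (@through_perm x)); rewrite x1 /= /through !inE eqxx /= => -[].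
  have := wf_eqv eL wL; rewrite /wf /= => wL'.
  have U' : uniq [:: x; y; z].
    move: U; rewrite all_count (eL uniq) ?(eqv_size eL) -?all_count /=; first by case/andP.
    by move=> ? ? /perm_uniq.
  (* [x] occurs neither in [L'] nor a second time on its own line, so its value is the product of
     the other two and constrains nothing else. *)
  apply: (@good_determined X x (fun v op f => op (f y) (f z))) (IH [::] L' wL' _).
  - move=> v op f sq /=; congr (_ && _).
    by case: (sq) => _ C _; rewrite [RHS]eq_sym C squag_swap.
  - by move=> v op f w; apply: all_sat_set_at.
  - move=> v op f w; move: U'; rewrite /= !inE negb_or => /andP[/andP[xy xz] _].
    by rewrite !set_at_neq // eq_sym.
  by rewrite (eqv_size eL).
(* Two lines through [x] and [y] have as third point the same product, so one of them becomes an
   equality. *)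
have [/existsP[x /existsP[y /andP[xy c2]]]|/existsPn D2] := boolP
    [exists x, exists y, (x != y) && (1 < count (through2 x y) L)]; last first.
  left; split=> // x y xy; rewrite leqNgt; have /existsPn/(_ y) := D2 x.
  by rewrite xy.
right; have [] := @pull2 L x y wL xy; first exact: ltnW.
move=> z [L1 e1]; have := wf_eqv e1 wL; rewrite /wf /= => wL1.
have [] := @pull2 L1 x y wL1 xy.
  by move: c2; rewrite (e1 _ (@through2_perm x y)) /= /through2 !inE !eqxx orbT.
move=> w [L2 e2]; have := wf_eqv e2 wL1; rewrite /wf /= => wL2.
have e3 : eqv L ([:: x; y; w] :: [:: x; y; z] :: L2).
  apply: (eqv_trans e1); apply: (eqv_trans (eqv_cat [:: _] e2)).
  by apply: eqv_perm; rewrite (perm_catCA [:: [:: x; y; z]] [:: [:: x; y; w]]).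
apply: (good_solutions_eqv e3); apply: (@good_eq_line [::] _ z w) => //.
  by move=> E L' wL' sL'; apply: IH; rewrite // (eqv_size e3) ltnS.
by move=> v op f sq /= /andP[/eqP -> _].
Qed.

End Systems.

(** * Irreducible systems: Pasch and mitre *)

Ltac neq_of_uniq U :=
  apply: contraTneq U => ->; by rewrite /= !inE !eqxx ?orbT /= ?andbF.

Section Irreducible.

Variable X : finType.
Implicit Types (E : seq (X * X)) (l : seq X) (L : seq (seq X)).

(** Eliminating [f] merges the two lines through it into ce = bd; then [c] and [e] are products, and
    only [a], [b], [d] remain. *)
Lemma good_pasch (a b c d e f : X) : uniq [:: a; b; c; d; e; f] ->
  good (solutions [::] [::]
    [:: [:: a; b; c]; [:: a; d; e]; [:: b; d; f]; [:: c; e; f]]).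
Proof.
move=> U.
apply: (@good_determined X f (fun v op h => op (h b) (h d)) (fun v op h =>
  [&& h c == op (h a) (h b), h e == op (h a) (h d) & op (h c) (h e) == op (h b) (h d)])).
- move=> v op h sq; rewrite /= !andbT (eq_sym (h f)) (eq_sym (h c)) (eq_sym (h e)).
  by case: (op (h b) (h d) =P h f) => [->|] //; rewrite ?andbF.
- by move=> v op h w; rewrite !set_at_neq //; neq_of_uniq U.
- by move=> v op h w; rewrite !set_at_neq //; neq_of_uniq U.
apply: (@good_determined X c (fun v op h => op (h a) (h b)) (fun v op h =>
  (h e == op (h a) (h d)) && (op (op (h a) (h b)) (h e) == op (h b) (h d)))).
- by move=> v op h sq; case: eqP => //= ->.
- by move=> v op h w; rewrite !set_at_neq //; neq_of_uniq U.
- by move=> v op h w; rewrite !set_at_neq //; neq_of_uniq U.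
apply: (@good_determined X e (fun v op h => op (h a) (h d))
  (fun v op h => pasch_eq op (h a) (h b) (h d))).
- by move=> v op h sq; case: eqP => //= ->.
- by move=> v op h w; rewrite !set_at_neq //; neq_of_uniq U.
- by move=> v op h w; rewrite !set_at_neq //; neq_of_uniq U.
apply: (@good_count3 _ _ _ _ Paschs _ _ (fun v op => erefl)).
by rewrite /= !inE negb_or !andbT; apply/andP; split; first (apply/andP; split); neq_of_uniq U.
Qed.

(** Eliminating [g] merges the two lines through it into ce = af; then [c], [e] and [f] are products
    of [a], [b], [d]. *)
Lemma good_mitre (a b c d e f g : X) : uniq [:: a; b; c; d; e; f; g] ->
  good (solutions [::] [::]
    [:: [:: a; b; c]; [:: a; d; e]; [:: a; f; g]; [:: b; d; f]; [:: c; e; g]]).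
Proof.
move=> U.
apply: (@good_determined X g (fun v op h => op (h c) (h e)) (fun v op h =>
  [&& h c == op (h a) (h b), h e == op (h a) (h d), h f == op (h b) (h d)
    & op (h c) (h e) == op (h a) (h f)])).
- move=> v op h sq; rewrite /= !andbT (eq_sym (h f)) (eq_sym (h c)) (eq_sym (h e)).
  rewrite (eq_sym (h g)); case: (op (h c) (h e) =P h g) => [->|]; last by rewrite !andbF.
  by rewrite (eq_sym (h g)) /= andbT; do 4!case: (_ == _).
- by move=> v op h w; rewrite !set_at_neq //; neq_of_uniq U.
- by move=> v op h w; rewrite !set_at_neq //; neq_of_uniq U.
apply: (@good_determined X c (fun v op h => op (h a) (h b)) (fun v op h =>
  [&& h e == op (h a) (h d), h f == op (h b) (h d)
    & op (op (h a) (h b)) (h e) == op (h a) (h f)])).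
- by move=> v op h sq; case: eqP => //= ->.
- by move=> v op h w; rewrite !set_at_neq //; neq_of_uniq U.
- by move=> v op h w; rewrite !set_at_neq //; neq_of_uniq U.
apply: (@good_determined X e (fun v op h => op (h a) (h d)) (fun v op h =>
  (h f == op (h b) (h d)) &&
  (op (op (h a) (h b)) (op (h a) (h d)) == op (h a) (h f)))).
- by move=> v op h sq; case: eqP => //= ->.
- by move=> v op h w; rewrite !set_at_neq //; neq_of_uniq U.
- by move=> v op h w; rewrite !set_at_neq //; neq_of_uniq U.
apply: (@good_determined X f (fun v op h => op (h b) (h d))
  (fun v op h => mitre_eq op (h a) (h b) (h d))).
- by move=> v op h sq; case: eqP => //= ->.
- by move=> v op h w; rewrite !set_at_neq //; neq_of_uniq U.
- by move=> v op h w; rewrite !set_at_neq //; neq_of_uniq U.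
apply: (@good_count3 _ _ _ _ Mitres _ _ (fun v op => erefl)).
by rewrite /= !inE negb_or !andbT; apply/andP; split; first (apply/andP; split); neq_of_uniq U.
Qed.

(** * Incidences in irreducible systems *)

Lemma size_line_sum L : wf L -> all uniq L ->
  \sum_x count (through x) L = 3 * size L.
Proof.
elim: L => [|l L IH] /=; first by rewrite big1.
move=> /andP[/eqP s3 wL] /andP[ul uL]; rewrite big_split /= IH // mulnS.
congr (_ + _); rewrite -s3 -(card_uniqP ul) -sum1_card [RHS]big_mkcond.
by apply: eq_bigr => x _; rewrite /through; case: (x \in l).
Qed.

(** Otherwise every point lies on no line or on exactly two, and the number of incidences, three
    times the number of lines, would be even. *)
Lemma exists_triple_point L : wf L -> irreducible L -> odd (size L) ->
  exists x, 2 < count (through x) L.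
Proof.
move=> wL [U D1 _] oL; apply/existsP; rewrite -[[exists _, _]]negbK; apply/negP.
rewrite negb_exists => /forallP H.
have := size_line_sum wL U; move/(congr1 odd); rewrite oddM oL /=.
suff -> : odd (\sum_x count (through x) L) = false by [].
rewrite (eq_bigr (fun x => (0 < count (through x) L).*2)) => [|x _].
  by elim/big_rec: _ => // x n _; rewrite oddD odd_double.
by have := H x; have := D1 x; rewrite -leqNgt; case: count => [|[|[|]]].
Qed.

(** A point met once so far must lie on a second line, which is still among the unexplored ones; it
    is moved to the end of the explored prefix [P]. *)
Lemma pull_again P L x : wf (P ++ L) -> irreducible (P ++ L) ->
  count (through x) P = 1 ->
  exists y z L', [/\ eqv (P ++ L) ((rcons P [:: x; y; z]) ++ L'),
    wf ((rcons P [:: x; y; z]) ++ L'), irreducible ((rcons P [:: x; y; z]) ++ L')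
    & size L = (size L').+1].
Proof.
move=> wL iL c1; have [] := @pull X L x.
- by move: wL; rewrite /wf all_cat => /andP[].
- by case: iL => _ /(_ x) + _; rewrite count_cat c1; case: count.
move=> y [z [L' eL]]; exists y, z, L'.
have e2 : eqv (P ++ L) ((rcons P [:: x; y; z]) ++ L').
  by rewrite cat_rcons; apply: eqv_cat.
split=> //; first exact: wf_eqv e2 wL.
  exact: irreducible_eqv e2 iL.
exact: eqv_size eL.
Qed.

(** Positions are compared rather than lines, so a line listed twice is excluded as well. *)
Lemma irr_notin L i j x y : irreducible L -> i < j -> j < size L -> x != y ->
  (x \in nth [::] L i) && (y \in nth [::] L i) ->
  (x \in nth [::] L j) -> (y \notin nth [::] L j).
Proof.
move=> [_ _ /(_ x y) D2] ij js xy Hi xj; apply/negP => yj.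
have := D2 xy; apply/negP; rewrite -ltnNge.
have h1 : 0 < count (through2 x y) (take j L).
  rewrite -has_count; apply/hasP; exists (nth [::] L i) => //.
  by rewrite -(nth_take _ ij) mem_nth // size_take js.
have h2 : 0 < count (through2 x y) (drop j L).
  by rewrite (drop_nth [::] js) /= {1}/through2 xj yj.
by rewrite -(cat_take_drop j L) count_cat; apply: (leq_add h1 h2).
Qed.

Lemma irr_notin_sym L i j x y : irreducible L -> i < j -> j < size L -> x != y ->
  (x \in nth [::] L j) && (y \in nth [::] L j) ->
  (x \in nth [::] L i) -> (y \notin nth [::] L i).
Proof.
move=> iL ij js xy /andP[xj yj] xi; apply/negP => yi.
by have := irr_notin iL ij js xy; rewrite xi yi xj yj => /(_ isT isT).
Qed.

Lemma irr_uniq L i : irreducible L -> i < size L -> uniq (nth [::] L i).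
Proof. by move=> [U _ _] iL; apply: (allP U); apply: mem_nth. Qed.

(** The line through [b] contains [d], hence not [e], so [e] lies on the line through [c]. The third
    point of the line through [b] needs a second line too, and only the one through [c] is left. *)
Lemma good_pasch_case (a b c d e p q r s : X) :
  let L := [:: [:: a; b; c]; [:: a; d; e]; [:: b; p; q]; [:: c; r; s]] in
  irreducible L -> d \in [:: b; p; q] -> good (solutions [::] [::] L).
Proof.
move=> L iL dl2.
have := irr_uniq (i := 0) iL isT; have := irr_uniq (i := 1) iL isT.
rewrite /= !inE !negb_or !andbT => /andP[/andP[ad ae] de] /andP[/andP[ab ac] bc].
have bl1 : b \notin [:: a; d; e].
  by apply: (irr_notin (i := 0) (j := 1) iL isT isT ab); rewrite /= !inE !eqxx ?orbT.
have cl1 : c \notin [:: a; d; e].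
  by apply: (irr_notin (i := 0) (j := 1) iL isT isT ac); rewrite /= !inE !eqxx ?orbT.
have dl0 : d \notin [:: a; b; c].
  by apply: (irr_notin_sym (i := 0) (j := 1) iL isT isT ad); rewrite /= !inE !eqxx ?orbT.
have el0 : e \notin [:: a; b; c].
  by apply: (irr_notin_sym (i := 0) (j := 1) iL isT isT ae); rewrite /= !inE !eqxx ?orbT.
have el2 : e \notin [:: b; p; q].
  by apply: (irr_notin (i := 1) (j := 2) iL isT isT de); rewrite /= ?dl2 // !inE !eqxx ?orbT.
have el3 : e \in [:: c; r; s].
  case: iL => _ /(_ e) + _; rewrite /= /through (negPf el0) (negPf el2).
  by rewrite !inE eqxx !orbT; case: (_ || _).
have bd : b != d by apply: contraNneq bl1 => ->; rewrite !inE eqxx orbT.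
have ce : c != e by apply: contraNneq cl1 => ->; rewrite !inE eqxx !orbT.
have [f pf] := perm_front3_2 (erefl : size [:: b; p; q] == 3) bd (mem_head _ _) dl2.
have [g pg] := perm_front3_2 (erefl : size [:: c; r; s] == 3) ce (mem_head _ _) el3.
have eL : eqv L [:: [:: a; b; c]; [:: a; d; e]; [:: b; d; f]; [:: c; e; g]].
  apply: (eqv_cat [:: _; _]); apply: (eqv_trans (eqv_line _ pf)).
  by apply: (eqv_cat [:: _]); apply: eqv_line.
apply: (good_solutions_eqv eL); have {}iL := irreducible_eqv eL iL.
have := irr_uniq (i := 2) iL isT; rewrite /= !inE !negb_or !andbT.
move=> /andP[/andP[_ bf] df].
have fl0 : f \notin [:: a; b; c].
  by apply: (irr_notin_sym (i := 0) (j := 2) iL isT isT bf); rewrite /= !inE !eqxx ?orbT.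
have fl1 : f \notin [:: a; d; e].
  by apply: (irr_notin_sym (i := 1) (j := 2) iL isT isT df); rewrite /= !inE !eqxx ?orbT.
have fl3 : f \in [:: c; e; g].
  case: iL => _ /(_ f) + _; rewrite /= /through (negPf fl0) (negPf fl1).
  by rewrite !inE eqxx !orbT; case: (_ || _).
have fg : f = g.
  move: fl3 fl0 fl1; rewrite !inE => /or3P[]/eqP // ->.
    by rewrite eqxx !orbT.
  by rewrite eqxx !orbT.
subst g; apply: good_pasch.
rewrite -[[:: a, b & _]]/([:: a; b; c] ++ [:: d; e; f]) cat_uniq.
rewrite (irr_uniq (i := 0) iL isT) /= !inE !negb_or de df.
move: dl0 el0 fl0 fl1; rewrite !inE !negb_or => -> -> -> /and3P[_ _].
by rewrite eq_sym => ->.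
Qed.

(** The line through [b] contains [d] and [f], hence neither [e] nor [g]; both must lie on the line
    through [c]. *)
Lemma good_mitre_case (a b c d e f g p q r s : X) :
  let L := [:: [:: a; b; c]; [:: a; d; e]; [:: a; f; g]; [:: b; p; q]; [:: c; r; s]] in
  irreducible L -> d \in [:: b; p; q] -> f \in [:: b; p; q] ->
  good (solutions [::] [::] L).
Proof.
move=> L iL dl3 fl3.
have U0 := irr_uniq (i := 0) iL isT; have U1 := irr_uniq (i := 1) iL isT.
have U2 := irr_uniq (i := 2) iL isT.
have := U0; have := U1; have := U2.
rewrite /= !inE !negb_or !andbT => /andP[/andP[af ag] fg] /andP[/andP[ad ae] de].
move=> /andP[/andP[ab ac] bc].
have bl1 : b \notin [:: a; d; e].
  by apply: (irr_notin (i := 0) (j := 1) iL isT isT ab); rewrite /= !inE !eqxx ?orbT.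
have bl2 : b \notin [:: a; f; g].
  by apply: (irr_notin (i := 0) (j := 2) iL isT isT ab); rewrite /= !inE !eqxx ?orbT.
have cl1 : c \notin [:: a; d; e].
  by apply: (irr_notin (i := 0) (j := 1) iL isT isT ac); rewrite /= !inE !eqxx ?orbT.
have cl2 : c \notin [:: a; f; g].
  by apply: (irr_notin (i := 0) (j := 2) iL isT isT ac); rewrite /= !inE !eqxx ?orbT.
have dl0 : d \notin [:: a; b; c].
  by apply: (irr_notin_sym (i := 0) (j := 1) iL isT isT ad); rewrite /= !inE !eqxx ?orbT.
have dl2 : d \notin [:: a; f; g].
  by apply: (irr_notin (i := 1) (j := 2) iL isT isT ad); rewrite /= !inE !eqxx ?orbT.
have el0 : e \notin [:: a; b; c].
  by apply: (irr_notin_sym (i := 0) (j := 1) iL isT isT ae); rewrite /= !inE !eqxx ?orbT.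
have el2 : e \notin [:: a; f; g].
  by apply: (irr_notin (i := 1) (j := 2) iL isT isT ae); rewrite /= !inE !eqxx ?orbT.
have fl0 : f \notin [:: a; b; c].
  by apply: (irr_notin_sym (i := 0) (j := 2) iL isT isT af); rewrite /= !inE !eqxx ?orbT.
have gl0 : g \notin [:: a; b; c].
  by apply: (irr_notin_sym (i := 0) (j := 2) iL isT isT ag); rewrite /= !inE !eqxx ?orbT.
have gl1 : g \notin [:: a; d; e].
  by apply: (irr_notin_sym (i := 1) (j := 2) iL isT isT ag); rewrite /= !inE !eqxx ?orbT.
have el3 : e \notin [:: b; p; q].
  by apply: (irr_notin (i := 1) (j := 3) iL isT isT de); rewrite /= ?dl3 // !inE !eqxx ?orbT.
have gl3 : g \notin [:: b; p; q].
  by apply: (irr_notin (i := 2) (j := 3) iL isT isT fg); rewrite /= ?fl3 // !inE !eqxx ?orbT.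
have el4 : e \in [:: c; r; s].
  case: iL => _ /(_ e) + _; rewrite /= /through (negPf el0) (negPf el2) (negPf el3).
  by rewrite !inE eqxx !orbT; case: (_ || _).
have gl4 : g \in [:: c; r; s].
  case: iL => _ /(_ g) + _; rewrite /= /through (negPf gl0) (negPf gl1) (negPf gl3).
  by rewrite !inE eqxx !orbT; case: (_ || _).
have bd : b != d by apply: contraNneq bl1 => ->; rewrite !inE eqxx orbT.
have ce : c != e by apply: contraNneq cl1 => ->; rewrite !inE eqxx !orbT.
have [f' pf] := perm_front3_2 (erefl : size [:: b; p; q] == 3) bd (mem_head _ _) dl3.
have [g' pg] := perm_front3_2 (erefl : size [:: c; r; s] == 3) ce (mem_head _ _) el4.
have ff : f = f'.
  move: fl3; rewrite (perm_mem pf) !inE => /or3P[]/eqP // E.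
    by move: bl2; rewrite -E !inE eqxx !orbT.
  by move: dl2; rewrite -E !inE eqxx !orbT.
have gg : g = g'.
  move: gl4; rewrite (perm_mem pg) !inE => /or3P[]/eqP // E.
    by move: cl2; rewrite -E !inE eqxx !orbT.
  by move: el2; rewrite -E !inE eqxx !orbT.
subst f' g'.
have eL : eqv L [:: [:: a; b; c]; [:: a; d; e]; [:: a; f; g]; [:: b; d; f]; [:: c; e; g]].
  apply: (eqv_cat [:: _; _; _]); apply: (eqv_trans (eqv_line _ pf)).
  by apply: (eqv_cat [:: _]); apply: eqv_line.
apply: (good_solutions_eqv eL); apply: good_mitre.
rewrite -[[:: a, b & _]]/([:: a; b; c] ++ [:: d; e; f; g]) cat_uniq U0.
rewrite /= !inE !negb_or de fg.
move: dl0 el0 fl0 gl0 dl2 el2; rewrite !inE !negb_or => -> -> -> ->.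
by move=> /and3P[_ -> ->] /and3P[_ -> ->].
Qed.

Lemma perm_last2 (x y z : X) : perm_eq [:: x; y; z] [:: x; z; y].
Proof. by rewrite perm_cons (perm_catC [:: y] [:: z]). Qed.

(** Besides three lines through [a], the points [b] and [c] of the first one need a further line
    each, and these differ; this exhausts the five lines. Each of the other two lines through [a]
    then has one point on either of the last two. *)
Lemma good_triple_point L a : wf L -> irreducible L -> size L = 5 ->
  2 < count (through a) L -> good (solutions [::] [::] L).
Proof.
move=> wL iL sL ca.
have [] := @pull X L a wL; first by apply: leq_trans ca.
move=> b [c [L1 e1]]; have w1 := wf_eqv e1 wL; move: (w1); rewrite /wf /= => wL1.
have [] := @pull X L1 a wL1.
  by move: ca; rewrite (e1 _ (@through_perm _ a)) /= {1}/through mem_head; case: count.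
move=> d [e [L2 e2]]; have w2 := wf_eqv e2 wL1; move: (w2); rewrite /wf /= => wL2.
have [] := @pull X L2 a wL2.
  move: ca; rewrite (e1 _ (@through_perm _ a)) /= {1}/through mem_head.
  by rewrite (e2 _ (@through_perm _ a)) /= {1}/through mem_head; case: count.
move=> f [g [L3 e3]].
have e4 : eqv L [:: [:: a; b; c], [:: a; d; e], [:: a; f; g] & L3].
  apply: (eqv_trans e1); apply: (eqv_trans (eqv_cat [:: _] e2)).
  exact: (eqv_cat [:: _; _] e3).
apply: (good_solutions_eqv e4); have {}iL := irreducible_eqv e4 iL.
have {}sL := etrans (esym (eqv_size e4)) sL; have {}wL := wf_eqv e4 wL.
move: sL => -[s3]; clear - wL iL s3.
have U0 := irr_uniq (i := 0) iL isT; have U1 := irr_uniq (i := 1) iL isT.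
have U2 := irr_uniq (i := 2) iL isT.
have := U0; have := U1; have := U2.
rewrite /= !inE !negb_or !andbT => /andP[/andP[af ag] fg] /andP[/andP[ad ae] de].
move=> /andP[/andP[ab ac] bc].
have bl1 : b \notin [:: a; d; e].
  by apply: (irr_notin (i := 0) (j := 1) iL isT isT ab); rewrite /= !inE !eqxx ?orbT.
have bl2 : b \notin [:: a; f; g].
  by apply: (irr_notin (i := 0) (j := 2) iL isT isT ab); rewrite /= !inE !eqxx ?orbT.
have [] := @pull_again [:: [:: a; b; c]; [:: a; d; e]; [:: a; f; g]] L3 b wL iL.
  by rewrite /= /through (negPf bl1) (negPf bl2) !inE eqxx orbT.
move=> p [q [L4 [e5 {wL} wL {iL} iL s4]]]; apply: (good_solutions_eqv e5).
have cl1 : c \notin [:: a; d; e].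
  by apply: (irr_notin (i := 0) (j := 1) iL isT isT ac); rewrite /= !inE !eqxx ?orbT.
have cl2 : c \notin [:: a; f; g].
  by apply: (irr_notin (i := 0) (j := 2) iL isT isT ac); rewrite /= !inE !eqxx ?orbT.
have cl3 : c \notin [:: b; p; q].
  by apply: (irr_notin (i := 0) (j := 3) iL isT isT bc); rewrite /= !inE !eqxx ?orbT.
have [] := @pull_again
  [:: [:: a; b; c]; [:: a; d; e]; [:: a; f; g]; [:: b; p; q]] L4 c wL iL.
  by rewrite /= /through (negPf cl1) (negPf cl2) (negPf cl3) !inE eqxx !orbT.
move=> r [s [L5 [e6 _ {}iL s5]]]; apply: (good_solutions_eqv e6).
have L50 : L5 = [::] by move: s3; rewrite s4 s5 => -[/size0nil].
rewrite L50 /= in iL *.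
(* [x] and [y] each need one of the last two lines and cannot share the one through [c], so after a
   possible exchange [x] is on the one through [b]. *)
have choose x y : count (through x) [:: [:: a; b; c]; [:: a; d; e]; [:: a; f; g]] = 1 ->
    count (through y) [:: [:: a; b; c]; [:: a; d; e]; [:: a; f; g]] = 1 ->
    ~~ ((x \in [:: c; r; s]) && (y \in [:: c; r; s])) ->
    exists x' y', perm_eq [:: a; x; y] [:: a; x'; y'] /\ x' \in [:: b; p; q].
  have D1 z : count (through z) ([:: [:: a; b; c]; [:: a; d; e]; [:: a; f; g]] ++
      [:: [:: b; p; q]; [:: c; r; s]]) != 1 by case: iL.
  move=> cx cy; have := D1 x; have := D1 y; rewrite !count_cat cx cy /= /through.
  have [xl3 _ _ _|_] := boolP (x \in [:: b; p; q]); first by exists x, y.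
  have [yl3 _ _ _|_] := boolP (y \in [:: b; p; q]).
    by exists y, x; split=> //; apply: perm_last2.
  by case: (x \in _); case: (y \in _).
have dl0 : d \notin [:: a; b; c].
  by apply: (irr_notin_sym (i := 0) (j := 1) iL isT isT ad); rewrite /= !inE !eqxx ?orbT.
have dl2 : d \notin [:: a; f; g].
  by apply: (irr_notin (i := 1) (j := 2) iL isT isT ad); rewrite /= !inE !eqxx ?orbT.
have el0 : e \notin [:: a; b; c].
  by apply: (irr_notin_sym (i := 0) (j := 1) iL isT isT ae); rewrite /= !inE !eqxx ?orbT.
have el2 : e \notin [:: a; f; g].
  by apply: (irr_notin (i := 1) (j := 2) iL isT isT ae); rewrite /= !inE !eqxx ?orbT.
have fl0 : f \notin [:: a; b; c].
  by apply: (irr_notin_sym (i := 0) (j := 2) iL isT isT af); rewrite /= !inE !eqxx ?orbT.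
have fl1 : f \notin [:: a; d; e].
  by apply: (irr_notin_sym (i := 1) (j := 2) iL isT isT af); rewrite /= !inE !eqxx ?orbT.
have gl0 : g \notin [:: a; b; c].
  by apply: (irr_notin_sym (i := 0) (j := 2) iL isT isT ag); rewrite /= !inE !eqxx ?orbT.
have gl1 : g \notin [:: a; d; e].
  by apply: (irr_notin_sym (i := 1) (j := 2) iL isT isT ag); rewrite /= !inE !eqxx ?orbT.
have [] := choose d e.
- by rewrite /= /through (negPf dl0) (negPf dl2) !inE eqxx orbT.
- by rewrite /= /through (negPf el0) (negPf el2) !inE eqxx !orbT.
- have [dl4|//] := boolP (d \in [:: c; r; s]).
  by apply: (irr_notin (i := 1) (j := 4) iL isT isT de); rewrite /= ?dl4 // !inE !eqxx ?orbT.
move=> d' [e' [pd dl3]]; have [] := choose f g.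
- by rewrite /= /through (negPf fl0) (negPf fl1) !inE eqxx orbT.
- by rewrite /= /through (negPf gl0) (negPf gl1) !inE eqxx !orbT.
- have [fl4|//] := boolP (f \in [:: c; r; s]).
  by apply: (irr_notin (i := 2) (j := 4) iL isT isT fg); rewrite /= ?fl4 // !inE !eqxx ?orbT.
move=> f' [g' [pf fl3]].
have eL : eqv [:: [:: a; b; c]; [:: a; d; e]; [:: a; f; g]; [:: b; p; q]; [:: c; r; s]]
    [:: [:: a; b; c]; [:: a; d'; e']; [:: a; f'; g']; [:: b; p; q]; [:: c; r; s]].
  apply: (eqv_cat [:: _]); apply: (eqv_trans (eqv_line _ pd)).
  by apply: (eqv_cat [:: _]); apply: eqv_line.
apply: (good_solutions_eqv eL); apply: good_mitre_case => //.
exact: irreducible_eqv eL iL.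
Qed.

(** The points of a first line [a b c] each need another line, and these three are distinct. So a
    nonempty system has four lines and is a Pasch, or has five and, by parity, a triple point. *)
Lemma good_irreducible L : wf L -> irreducible L -> size L <= 5 ->
  good (solutions [::] [::] L).
Proof.
move=> wL iL s5; case: L wL iL s5 => [|l L1] wL iL s5.
  apply: eq_good (good_eval (Power Order #|X|)) => v op sq.
  rewrite eval_Power /= -[in LHS](card_ord v) -card_ffun.
  by apply: eq_card => f; rewrite !inE.
move: (wL); rewrite /wf /= => /andP[sl _].
case: l sl wL iL s5 => [|a [|b [|c []]]] //= _ wL iL s1; rewrite ltnS in s1.
have U0 := irr_uniq (i := 0) iL isT; have := U0.
rewrite /= !inE !negb_or !andbT => /andP[/andP[ab ac] bc].
have [] := @pull_again [:: [:: a; b; c]] L1 a wL iL.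
  by rewrite /= /through mem_head.
move=> d [e [L2 [e2 {wL} wL {iL} iL s2]]]; apply: (good_solutions_eqv e2).
have bl1 : b \notin [:: a; d; e].
  by apply: (irr_notin (i := 0) (j := 1) iL isT isT ab); rewrite /= !inE !eqxx ?orbT.
have [] := @pull_again [:: [:: a; b; c]; [:: a; d; e]] L2 b wL iL.
  by rewrite /= /through (negPf bl1) !inE eqxx orbT.
move=> p [q [L3 [e3 {wL} wL {iL} iL s3]]]; apply: (good_solutions_eqv e3).
have cl1 : c \notin [:: a; d; e].
  by apply: (irr_notin (i := 0) (j := 1) iL isT isT ac); rewrite /= !inE !eqxx ?orbT.
have cl2 : c \notin [:: b; p; q].
  by apply: (irr_notin (i := 0) (j := 2) iL isT isT bc); rewrite /= !inE !eqxx ?orbT.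
have [] := @pull_again [:: [:: a; b; c]; [:: a; d; e]; [:: b; p; q]] L3 c wL iL.
  by rewrite /= /through (negPf cl1) (negPf cl2) !inE eqxx !orbT.
move=> r [s [L4 [e4 {wL} wL {iL} iL s4]]]; apply: (good_solutions_eqv e4).
case: L4 e4 wL iL s4 => [|l5 [|l6 L4]] /= e4 wL iL s4; last 2 first.
- have w5 : wf [:: [:: a; b; c]; [:: a; d; e]; [:: b; p; q]; [:: c; r; s]; l5] by [].
  have [x cx] := exists_triple_point w5 iL isT.
  exact: good_triple_point cx.
- by move: s1; rewrite s2 s3 s4.
have := irr_uniq (i := 1) iL isT.
rewrite /= !inE !negb_or !andbT => /andP[/andP[ad ae] de].
have dl0 : d \notin [:: a; b; c].
  by apply: (irr_notin_sym (i := 0) (j := 1) iL isT isT ad); rewrite /= !inE !eqxx ?orbT.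
have [dl2|dl2] := boolP (d \in [:: b; p; q]); first exact: good_pasch_case.
(* The second line through [d] can only be the one through [c]; exchanging [b] and [c] returns to
   the previous case. *)
have dl3 : d \in [:: c; r; s].
  have [_ /(_ d)] := iL; rewrite /= /through (negPf dl0) (negPf dl2) (_ : d \in [:: a; d; e]).
    by case: (d \in _).
  by rewrite !inE eqxx orbT.
have eL : eqv [:: [:: a; b; c]; [:: a; d; e]; [:: b; p; q]; [:: c; r; s]]
    [:: [:: a; c; b]; [:: a; d; e]; [:: c; r; s]; [:: b; p; q]].
  apply: (eqv_trans (eqv_line _ (perm_last2 _ _ _))); apply: (eqv_cat [:: _; _]).
  by apply: eqv_perm; rewrite (perm_catC [:: _] [:: _]).
apply: (good_solutions_eqv eL); apply: good_pasch_case => //.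
exact: irreducible_eqv eL iL.
Qed.

(** The outer induction is on the number of lines, with [E] arbitrary because removing a line may
    add an equality; the inner one removes equalities by substitution. *)
Lemma good_lines L : wf L -> size L <= 5 -> forall E, good (solutions E [::] L).
Proof.
move: {2}(size L) (leqnn (size L)) => n.
elim/ltn_ind: n L => n IH L sn wL s5.
have G0 L' : wf L' -> size L' <= size L -> good (solutions [::] [::] L').
  move=> wL' sL'; have [] := @irreducible_or_good X L' wL'.
  - move=> E M wM sM; apply: (IH (size M)) => //.
      exact: leq_trans (leq_trans sM sL') sn.
    by apply: leq_trans s5; apply: leq_trans sL'; apply: ltnW.
  - by move=> iL'; apply: good_irreducible => //; apply: leq_trans sL' s5.
  by [].
suff H k L' E : size L' <= size L -> wf L' -> size E <= k ->
    good (solutions E [::] L') by move=> E; apply: (H (size E)).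
elim: k L' E => [|k IHk] L' [|[a b] E] //= sL' wL' sE; try exact: G0.
have [->|ab] := eqVneq a b.
  apply: eq_good (IHk L' E sL' wL' sE) => v op sq.
  by apply: eq_card => f; rewrite !inE /= {2}/sat_eq /= eqxx.
(* [m] never takes the value [b], so the substituted system leaves that coordinate free and f b = f
   a determines it. *)
pose m x := if x == b then a else x.
have := IHk [seq map m l | l <- L'] [seq (m e.1, m e.2) | e <- E].
rewrite !size_map => /(_ sL' _ sE) H.
apply: (@good_determined X b (fun v op f => f a)) (H _).
- move=> v op f sq /=; rewrite {1}/sat_eq /= eq_sym -!andbA; case: eqP => //= fb.
  have fm x : f (m x) = f x by rewrite /m; case: eqP => // ->.
  rewrite !all_map; congr (_ && _); apply: eq_all.
    by move=> [x y]; rewrite /sat_eq /= !fm.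
  by case=> [|x [|y [|z []]]] //=; rewrite !fm.
- have mb x : m x != b by rewrite /m; case: (eqVneq x b).
  move=> v op f w; rewrite /= !all_map; congr (_ && _); apply: eq_all.
    by move=> [x y]; rewrite /sat_eq /= !set_at_neq.
  by case=> [|x [|y [|z []]]] //=; rewrite !set_at_neq.
- by move=> v op f w; rewrite set_at_neq.
by rewrite /wf all_map (eq_all (a2 := fun l => size l == 3)) // => l /=; rewrite size_map.
Qed.

(** Inclusion-exclusion one pair at a time: the maps separating [a] and [b] are all maps minus those
    identifying them. *)
Lemma good_solutions E D L : wf L -> size L <= 5 -> good (solutions E D L).
Proof.
move=> wL sL; elim: D E => [|[a b] D IH] E; first exact: good_lines.
apply: (good_sub (IH ((a, b) :: E))); apply: eq_good (IH E) => v op sq.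
rewrite /solutions -(cardsID [set f : {ffun X -> 'I_v} | f a == f b]) addnC.
congr (_ + _); apply: eq_card => f; rewrite !inE /= [in RHS]/sat_eq /=.
  by case: (f a == f b); rewrite ?andbF.
by case: (f a == f b); rewrite ?andbF ?andbT.
Qed.

End Irreducible.

(** * Copies of a configuration *)

Section Copies.

Variables (V : finType) (C : {set {set V}}) (x0 : V).
Hypothesis x0C : x0 \in cover C.

(* Sending every point off the configuration to the image of [x0] makes a copy
   of C correspond to the same number of maps whatever the order is. *)
Definition copy_map (W : finType) (D : {set {set W}}) (f : {ffun V -> W}) : bool :=
  [&& [forall x, (x \notin cover C) ==> (f x == f x0)],
      dinjectiveb f (cover C) & [set f @: (l : {set V}) | l in C] == D].

Lemma copy_mapP (W : finType) (D : {set {set W}}) (f : {ffun V -> W}) :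
  reflect [/\ forall x, x \notin cover C -> f x = f x0,
              {in cover C &, injective f} & [set f @: (l : {set V}) | l in C] = D]
    (copy_map D f).
Proof.
apply: (iffP and3P) => -[H1 H2 H3]; split.
- by move=> x xC; apply/eqP; move/forallP/(_ x): H1; rewrite xC.
- exact/dinjectiveP.
- exact/eqP.
- by apply/forallP=> x; apply/implyP=> xC; apply/eqP/H1.
- exact/dinjectiveP.
exact/eqP.
Qed.

Lemma copy_map_cover (W : finType) (D : {set {set W}}) (f : {ffun V -> W}) x :
  copy_map D f -> f x \in f @: cover C /\ f x \in cover D.
Proof.
case/copy_mapP=> off _ <-.
have [y yC ->] : exists2 y, y \in cover C & f x = f y.
  by have [xC|/off] := boolP (x \in cover C); [exists x | exists x0].
split; first exact: imset_f.
by case/bigcupP: yC => l lC yl; apply/bigcupP; exists (f @: l); apply: imset_f.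
Qed.

Lemma eq_imset_sub (W : finType) (f : V -> W) (S S' : {set V}) :
  {in cover C &, injective f} -> S \subset cover C -> S' \subset cover C ->
  f @: S = f @: S' -> S = S'.
Proof.
move=> inj /subsetP sS /subsetP sS' E; apply/setP=> x; apply/idP/idP => xS.
  have : f x \in f @: S' by rewrite -E imset_f.
  by case/imsetP=> y yS' fxy; rewrite (inj x y (sS x xS) (sS' y yS') fxy).
have : f x \in f @: S by rewrite E imset_f.
by case/imsetP=> y yS fxy; rewrite (inj x y (sS' x xS) (sS y yS) fxy).
Qed.

(** Composition with a fixed isomorphism from [C] to [D] is a bijection, so every copy is hit as
    often as [C] has automorphisms. *)
Lemma card_copy_map (W : finType) (D : {set {set W}}) : config_iso C D ->
  #|[set f | copy_map D f]| = #|[set g | copy_map C g]|.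
Proof.
case/existsP=> f0 /andP[/dinjectiveP inj0 /eqP D0].
have subC l : l \in C -> l \subset cover C by move=> lC; apply: bigcup_sup.
have im2 (U : finType) (f1 : V -> U) (g : V -> V) (f : V -> U) :
    (forall x, f1 (g x) = f x) ->
    [set f1 @: (l : {set V}) | l in [set g @: (l : {set V}) | l in C]] =
    [set f @: (l : {set V}) | l in C].
  move=> E; rewrite -imset_comp; apply: eq_imset => l /=.
  by rewrite -imset_comp; apply: eq_imset => x /=.
pose comp (g : {ffun V -> V}) : {ffun V -> W} := [ffun x => f0 (g x)].
rewrite -(@card_in_imset _ _ comp); last first.
  move=> g h; rewrite !inE => Gg Gh /ffunP E; apply/ffunP => x.
  have := E x; rewrite !ffunE => /inj0; apply.
    by case: (copy_map_cover x Gg).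
  by case: (copy_map_cover x Gh).
apply: eq_card => f; rewrite inE; apply/idP/imsetP => [Hf|[g]]; last first.
  rewrite inE => Hg ->; have gC x : g x \in cover C by case: (copy_map_cover x Hg).
  case/copy_mapP: Hg => off inj im; apply/copy_mapP; split.
  - by move=> x /off E; rewrite !ffunE E.
  - by move=> x y xC yC; rewrite !ffunE => /inj0 E; apply: inj => //; apply: E.
  by rewrite -(im2 _ f0 g) ?im // => x; rewrite ffunE.
have fC x : exists2 y, y \in cover C & f x = f0 y.
  have [_] := copy_map_cover x Hf; rewrite -D0 => /bigcupP[l'] /imsetP[l lC ->].
  by case/imsetP=> y yl ->; exists y => //; apply: (subsetP (subC l lC)).
(* [f0] is injective only on [cover C], so preimages are chosen there. *)
pose g : {ffun V -> V} := [ffun x => odflt x0 [pick y in cover C | f x == f0 y]].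
have [gC f0g] : (forall x, g x \in cover C) /\ (forall x, f0 (g x) = f x).
  split=> x; rewrite ffunE; case: pickP => [y /andP[yC /eqP]|] //= H.
  by have [y yC E] := fC x; have := H y; rewrite yC E eqxx.
exists g; last by apply/ffunP=> x; rewrite ffunE f0g.
case/copy_mapP: Hf => off inj im.
rewrite inE; apply/copy_mapP; split.
- by move=> x /off E; apply: inj0 => //; rewrite !f0g.
- by move=> x y xC yC E; apply: inj => //; rewrite -!f0g E.
have subg (l : {set V}) : g @: l \subset cover C by apply/subsetP=> _ /imsetP[x _ ->].
(* Both families consist of subsets of [cover C], where [f0] can be cancelled, so they may be
   compared after applying it. *)
have E : [set f0 @: (l : {set V}) | l in [set g @: (l : {set V}) | l in C]] =
         [set f0 @: (l : {set V}) | l in C] by rewrite (im2 _ f0 g f) // D0.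
apply/setP=> l; apply/idP/idP => lC.
  have : f0 @: l \in [set f0 @: (l : {set V}) | l in C] by rewrite -E imset_f.
  case/imsetP=> l' l'C /eq_imset_sub -> //; last exact: subC.
  by case/imsetP: lC => k _ ->.
have : f0 @: l \in [set f0 @: (l : {set V}) | l in [set g @: (l : {set V}) | l in C]].
  by rewrite E imset_f.
case/imsetP=> l' /imsetP[k kC ->] /eq_imset_sub -> //; first exact: imset_f.
exact: subC.
Qed.

Lemma copy_maps_gt0 : 0 < #|[set g | copy_map C g]|.
Proof.
rewrite card_gt0; apply/set0Pn.
pose g : {ffun V -> V} := [ffun x => if x \in cover C then x else x0].
exists g; rewrite inE; apply/copy_mapP; split.
- by move=> x xC; rewrite !ffunE (negPf xC) x0C.
- by move=> x y xC yC; rewrite !ffunE xC yC.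
rewrite -[RHS]imset_id; apply: eq_in_imset => l lC.
rewrite -[RHS]imset_id; apply: eq_in_imset => x xl.
by rewrite ffunE (subsetP (bigcup_sup l lC) x xl).
Qed.

Hypothesis card_lines : forall l, l \in C -> #|l| = 3.

Definition off_eqs : seq (V * V) := [seq (x, x0) | x <- enum (~: cover C)].
Definition point_neqs : seq (V * V) :=
  [seq p <- enum {: V * V} | [&& p.1 \in cover C, p.2 \in cover C & p.1 != p.2]].
Definition line_seqs : seq (seq V) := [seq enum l | l : {set V} <- enum C].

Lemma wf_line_seqs : wf line_seqs.
Proof.
rewrite /wf all_map; apply/allP=> l; rewrite mem_enum => lC /=.
by rewrite -cardE card_lines.
Qed.

(** Once the images of the points are distinct, the product equation of a line says precisely that
    its image is a block; without the disequalities it would also admit degenerate images. *)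
Lemma copies_system v (B : {set {set 'I_v}}) (f : {ffun V -> 'I_v}) :
  steiner_triple_system B ->
  [&& all (sat_eq f) off_eqs, all (predC (sat_eq f)) point_neqs
    & all (sat (line_op B) f) line_seqs] =
  (([set f @: (l : {set V}) | l in C] \subset B) &&
   copy_map [set f @: (l : {set V}) | l in C] f).
Proof.
move=> sts; rewrite /copy_map eqxx andbT [RHS]andbC -andbA; congr (_ && _).
  rewrite all_map; apply/allP/forallP => H x.
    by apply/implyP=> xC; apply: (H x); rewrite mem_enum inE.
  by rewrite mem_enum inE => xC; have := H x; rewrite xC.
have -> : all (predC (sat_eq f)) point_neqs = dinjectiveb f (cover C).
  apply/allP/dinjectiveP => H.
    move=> x y xC yC E; apply/eqP; apply/negPn/negP => xy.
    have := H (x, y); rewrite mem_filter /= xC yC xy mem_enum /= /sat_eq /= E eqxx.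
    by move/(_ isT).
  case=> x y; rewrite mem_filter /= => /andP[/and3P[xC yC xy] _].
  by rewrite /sat_eq /=; apply: contraNneq xy => /H ->.
case: (boolP (dinjectiveb f _)) => // /dinjectiveP inj /=.
have -> : ([set f @: (l : {set V}) | l in C] \subset B) = [forall l in C, f @: (l : {set V}) \in B].
  apply/subsetP/forall_inP => H; first by move=> l lC; apply: H; apply: imset_f.
  by move=> _ /imsetP[l lC ->]; apply: H.
suff satE l : l \in C -> sat (line_op B) f (enum l) = (f @: l \in B).
  rewrite all_map; apply/allP/forall_inP => H l.
    by move=> lC; rewrite -satE //; apply: H; rewrite mem_enum.
  by rewrite mem_enum => lC /=; rewrite satE ?H.
move=> lC; have lE := enum_uniq l; have mE := mem_enum l; have sE := card_lines lC.
rewrite cardE in sE.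
case: (enum l) lE mE sE => [|a [|b [|c []]]] //= U mE _.
have lab : l = [set a; b; c] by apply/setP=> x; rewrite -mE !inE orbA.
have inC x : x \in l -> x \in cover C by apply: subsetP; apply: bigcup_sup.
have neq x y : x \in l -> y \in l -> x != y -> f x != f y.
  by move=> xl yl; apply: contraNneq => E; apply/eqP; apply: inj; rewrite ?inC.
move: U; rewrite !inE negb_or andbT => /andP[/andP[ab ac] bc].
have [al bl cl] : [/\ a \in l, b \in l & c \in l].
  by rewrite lab !inE !eqxx ?orbT.
rewrite line_opE ?(neq a b) // ![f c == _]eq_sym (neq a c) // (neq b c) //=.
by rewrite lab !imsetU !imset_set1.
Qed.

(** The solutions are grouped by the copy that is their image, and all groups have the same size. *)
Lemma solutions_copies v (B : {set {set 'I_v}}) : steiner_triple_system B ->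
  solutions off_eqs point_neqs line_seqs (line_op B) =
  occurrences C B * #|[set g | copy_map C g]|.
Proof.
move=> sts; rewrite /solutions /occurrences.
pose h (f : {ffun V -> 'I_v}) := [set f @: (l : {set V}) | l in C].
rewrite -[LHS]sum1_card (partition_big h (fun D =>
  D \in [set D : {set {set 'I_v}} | (D \subset B) && config_iso C D])) /=; last first.
  move=> f; rewrite !inE copies_system // => /andP[-> /and3P[_ inj _]] /=.
  by apply/existsP; exists f; rewrite inj /=.
rewrite -sum_nat_const; apply: eq_bigr => D; rewrite inE => /andP[DB iso].
rewrite -(card_copy_map iso) -sum1_card; apply: eq_bigl => f.
rewrite !inE copies_system // -/(h f); have [E|hD] := eqVneq (h f) D.
  by rewrite E DB andbT.
rewrite andbF; apply/esym/negP => /copy_mapP[_ _ E].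
by rewrite /h E eqxx in hD.
Qed.

End Copies.

Lemma cover_neq0 (V : finType) (C : {set {set V}}) :
  (forall l, l \in C -> #|l| = 3) -> 0 < #|C| -> exists x, x \in cover C.
Proof.
rewrite card_gt0 => C3 /set0Pn[l lC].
have [x xl] : exists x, x \in l by apply/set0Pn; rewrite -card_gt0 C3.
by exists x; apply/bigcupP; exists l.
Qed.

Lemma occurrences_formula (V : finType) (C : {set {set V}}) :
  (forall l, l \in C -> #|l| = 3) -> #|C| = 5 ->
  exists d K p q, 0 < d /\ forall v (B : {set {set 'I_v}}),
    steiner_triple_system B ->
    let ev := eval v (count3 (pasch_eq (line_op B))) (count3 (mitre_eq (line_op B))) in
    v ^ K * d * occurrences C B + ev q = ev p.
Proof.
move=> C3 C5.
have [x0 x0C] : exists x, x \in cover C by apply: cover_neq0; rewrite ?C5.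
have [|K [p [q H]]] := good_solutions (off_eqs C x0) (point_neqs C) (wf_line_seqs C3).
  by rewrite size_map -cardE C5.
exists #|[set g | copy_map C x0 C g]|, K, p, q; split; first exact: copy_maps_gt0.
move=> v B sts; have := H v (line_op B) (line_op_squag sts).
by rewrite solutions_copies // (mulnC (occurrences _ _)) mulnA.
Qed.

(** * Relocatable RAM code *)

(* Code is a function of the address at which it is placed, because jump
   targets are absolute. *)
Definition code : Type := nat -> seq instr.

Definition assertion : Type := (nat -> nat) -> (nat -> nat) -> Prop.

Definition runs (p : program) (N : nat) (s : state) (n : nat) (s' : state) : Prop :=
  iter n (step p) s = s' /\
  forall k, k <= n -> words_below N (iter k (step p) s).

Lemma runs_trans p N s1 n1 s2 n2 s3 :
  runs p N s1 n1 s2 -> runs p N s2 n2 s3 -> runs p N s1 (n1 + n2) s3.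
Proof.
move=> [E1 B1] [E2 B2]; split; first by rewrite addnC iterD E1.
move=> k; case: (leqP k n1) => [/B1 //|/ltnW n1k] kn.
by rewrite -(subnK n1k) iterD E1; apply: B2; rewrite leq_subLR.
Qed.

Lemma runs_refl p N s : words_below N s -> runs p N s 0 s.
Proof. by move=> H; split=> // k; rewrite leqn0 => /eqP ->. Qed.

Lemma runs_step pre i post N r m s' :
  words_below N (State (size pre) r m) -> words_below N s' ->
  exec i (State (size pre) r m) = s' ->
  runs (pre ++ i :: post) N (State (size pre) r m) 1 s'.
Proof.
move=> H1 H2 E.
have Es : step (pre ++ i :: post) (State (size pre) r m) = s'.
  rewrite /step /= (_ : onth _ _ = Some i) // /onth.
  by elim: pre {H1 E} => //= a pre ->.
by split=> [|[|[|k]]] //= _; rewrite Es.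
Qed.

(** A total-correctness Hoare triple with a step bound and a word bound. Quantifying over the
    surrounding program is what allows absolute jump targets to compose. *)
Definition triple (N T : nat) (P : assertion) (c : code) (Q : assertion) : Prop :=
  forall pre post r m,
    words_below N (State (size pre) r m) -> P r m ->
    exists n r' m',
      [/\ n <= T, Q r' m' &
          runs (pre ++ c (size pre) ++ post) N (State (size pre) r m) n
            (State (size pre + size (c (size pre))) r' m')].

Lemma triple_post N T (P Q Q' : assertion) c :
  (forall r m, Q r m -> Q' r m) -> triple N T P c Q -> triple N T P c Q'.
Proof.
move=> QQ H pre post r m w Pr; have [n [r' [m' [nT Qr R]]]] := H pre post r m w Pr.
by exists n, r', m'; split=> //; apply: QQ.
Qed.

Definition seqc (c1 c2 : code) : code := fun o => c1 o ++ c2 (o + size (c1 o)).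

Lemma triple_seq N T1 T2 (P Q R : assertion) c1 c2 :
  triple N T1 P c1 Q -> triple N T2 Q c2 R ->
  triple N (T1 + T2) P (seqc c1 c2) R.
Proof.
move=> H1 H2 pre post r m w Pr; rewrite /seqc; set o := size pre.
have [n1 [r1 [m1 [nT1 Q1 R1]]]] := H1 pre (c2 (o + size (c1 o)) ++ post) r m w Pr.
have [_ /(_ n1 (leqnn _))] := R1; case: (R1) => -> _ w1.
have := H2 (pre ++ c1 o) post r1 m1; rewrite size_cat -/o => /(_ w1 Q1).
move=> [n2 [r2 [m2 [nT2 Q2 R2]]]]; exists (n1 + n2), r2, m2; split=> //.
  exact: leq_add.
rewrite size_cat addnA -!catA in R1 R2 *; exact: runs_trans R1 R2.
Qed.

(** Weakest precondition of straight-line code. Only [Const], [Add] and [Mul] carry an overflow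
    condition: truncated subtraction and division do not exceed their first operand, and the memory
    instructions move existing words. *)
Fixpoint wp (N : nat) (b : seq instr) (Q : assertion) (r m : nat -> nat) : Prop :=
  match b with
  | [::] => Q r m
  | i :: b' =>
    match i with
    | Const d n => n < N /\ wp N b' Q (update r d n) m
    | Add d x y => r x + r y < N /\ wp N b' Q (update r d (r x + r y)) m
    | Defs.Sub d x y => wp N b' Q (update r d (r x - r y)) m
    | Mul d x y => r x * r y < N /\ wp N b' Q (update r d (r x * r y)) m
    | Div d x y => wp N b' Q (update r d (r x %/ r y)) m
    | Read d x => wp N b' Q (update r d (m (r x))) m
    | Write x y => wp N b' Q r (update m (r x) (r y))
    | Jlt _ _ _ => False
    end
  end.

Definition block (b : seq instr) : code := fun _ => b.

Lemma update_below N f i x : (forall j, f j < N) -> x < N ->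
  forall j, update f i x j < N.
Proof. by move=> H Hx j; rewrite /update; case: eqP. Qed.

Lemma triple_block N b Q : triple N (size b) (wp N b Q) (block b) Q.
Proof.
rewrite /block; elim: b => [|i b IH] pre post r m w /=.
  by move=> Qr; exists 0, r, m; split=> //; rewrite addn0; apply: runs_refl.
suff H r1 m1 : words_below N (State (size pre).+1 r1 m1) -> wp N b Q r1 m1 ->
    exec i (State (size pre) r m) = State (size pre).+1 r1 m1 ->
    exists n r' m', [/\ n <= (size b).+1, Q r' m' &
      runs (pre ++ i :: b ++ post) N (State (size pre) r m) n
        (State (size pre + (size b).+1) r' m')].
  have [wr wm] := w; case: i H => /=.
  - by move=> d n H [Hn Hw]; apply: (H _ _ _ Hw) => //; split=> //; apply: update_below.
  - by move=> d x y H [Hn Hw]; apply: (H _ _ _ Hw) => //; split=> //; apply: update_below.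
  - move=> d x y H Hw; apply: (H _ _ _ Hw) => //; split=> //; apply: update_below => //.
    exact: leq_ltn_trans (leq_subr _ _) (wr x).
  - by move=> d x y H [Hn Hw]; apply: (H _ _ _ Hw) => //; split=> //; apply: update_below.
  - move=> d x y H Hw; apply: (H _ _ _ Hw) => //; split=> //; apply: update_below => //.
    exact: leq_ltn_trans (leq_div _ _) (wr x).
  - by move=> d x H Hw; apply: (H _ _ _ Hw) => //; split=> //; apply: update_below => //; apply: wm.
  - by move=> x y H Hw; apply: (H _ _ _ Hw) => //; split=> //; apply: update_below => //; apply: wr.
  by [].
move=> w1 Hwp E.
have := IH (rcons pre i) post r1 m1; rewrite size_rcons => /(_ w1 Hwp).
move=> [n [r' [m' [nT Qr R]]]]; exists n.+1, r', m'; split=> //.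
have := runs_step (b ++ post) w w1 E => R1.
by rewrite cat_rcons addSnnS in R; apply: runs_trans R1 R.
Qed.

Lemma triple_wp N T b (P Q : assertion) :
  size b <= T -> (forall r m, P r m -> wp N b Q r m) -> triple N T P (block b) Q.
Proof.
move=> bT PQ pre post r m w /PQ Hwp.
have [n [r' [m' [nb Qr R]]]] := @triple_block N b Q pre post r m w Hwp.
by exists n, r', m'; split=> //; apply: leq_trans bT.
Qed.

(* Registers 2 and 3 hold 1 and 0, so [Jlt 3 2] always jumps: it enters the
   loop at the test, which comes last. The body increments the counter. *)
Definition loop (i n : nat) (body : code) : code := fun o =>
  [:: Const i 0; Jlt 3 2 (o.+2 + size (body o.+2))]
    ++ body o.+2 ++ [:: Jlt i n o.+2].

(** Each round costs the body and one test. The additional 3 steps are the reset of the counter, the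
    jump to the test and the final failing test. *)
Lemma triple_loop N T i n len (P : assertion) (J : nat -> assertion) body :
  (forall r m, P r m -> update r i 0 3 < update r i 0 2 /\ J 0 (update r i 0) m) ->
  (forall k r m, J k r m -> r i = k /\ r n = len) ->
  (forall k, k < len -> triple N T (J k) body (J k.+1)) ->
  triple N (len * T.+1 + 3) P (loop i n body) (J len).
Proof.
move=> HP HJ Hb pre post r m w Pr; rewrite /loop; set o := size pre.
set B := body o.+2; set t := o.+2 + size B; set p := pre ++ _ ++ post.
have [lt32 J0] := HP _ _ Pr.
have N0 : 0 < N by apply: leq_ltn_trans (proj1 w 0).
have w1 : words_below N (State o.+1 (update r i 0) m).
  by case: w => wr wm; split=> //; apply: update_below.
have R1 : runs p N (State o r m) 1 (State o.+1 (update r i 0) m).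
  exact: runs_step.
have R2 : runs p N (State o.+1 (update r i 0) m) 1 (State t (update r i 0) m).
  have -> : p = rcons pre (Const i 0) ++ (Jlt 3 2 t :: B ++ [:: Jlt i n o.+2] ++ post).
    by rewrite cat_rcons /p /= -catA.
  rewrite -[o.+1](size_rcons pre (Const i 0)); apply: runs_step => //=.
  by rewrite lt32.
(* Induction on the number [k] of remaining rounds. *)
suff H k r1 m1 : k <= len -> J (len - k) r1 m1 -> words_below N (State t r1 m1) ->
    exists n r' m', [/\ n <= k * T.+1 + 1, J len r' m' &
      runs p N (State t r1 m1) n (State t.+1 r' m')].
  have := H len _ _ (leqnn _); rewrite subnn => /(_ _ _ J0 w1).
  move=> [n' [r' [m' [nT Jl R]]]]; exists (1 + (1 + n')), r', m'; split=> //.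
    by rewrite addnA (addnC 2) (leq_trans (leq_add nT (leqnn 2))) // -addnA.
  have -> : o + size ([:: Const i 0; Jlt 3 2 t] ++ B ++ [:: Jlt i n o.+2]) = t.+1.
    by rewrite /= size_cat /= addn1 !addnS /t !addSn.
  by apply: (runs_trans R1); apply: (runs_trans R2).
have pE : p = (pre ++ [:: Const i 0; Jlt 3 2 t] ++ B) ++ (Jlt i n o.+2 :: post).
  by rewrite /p -!catA.
have st : size (pre ++ [:: Const i 0; Jlt 3 2 t] ++ B) = t.
  by rewrite size_cat /= !addnS /t !addSn.
have Rt r2 m2 s' : words_below N (State t r2 m2) -> words_below N s' ->
    exec (Jlt i n o.+2) (State t r2 m2) = s' -> runs p N (State t r2 m2) 1 s'.
  have := @runs_step _ (Jlt i n o.+2) post N r2 m2 s'.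
  by move/(_ (pre ++ [:: Const i 0; Jlt 3 2 t] ++ B)); rewrite -pE st.
elim: k r1 m1 => [|k IH] r1 m1 klen Jk wk; have [ri rn] := HJ _ _ _ Jk.
  rewrite subn0 in Jk ri; exists 1, r1, m1; split=> //.
  by apply: Rt => //=; rewrite ri rn ltnn.
have R3 : runs p N (State t r1 m1) 1 (State o.+2 r1 m1).
  by apply: Rt => //=; rewrite ri rn ltn_subrL (leq_ltn_trans _ klen).
have lk : len - k.+1 < len by rewrite ltn_subrL (leq_ltn_trans _ klen).
have := Hb _ lk (pre ++ [:: Const i 0; Jlt 3 2 t]) ([:: Jlt i n o.+2] ++ post) r1 m1.
rewrite size_cat /= addn2 -/o -/B -/t => /(_ wk Jk) [n1 [r2 [m2 [nT1 J1 R4]]]].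
have {}R4 : runs p N (State o.+2 r1 m1) n1 (State t r2 m2) by rewrite /p -!catA in R4 *.
have w2 : words_below N (State t r2 m2) by case: R4 => <- /(_ n1); apply.
rewrite -subSn // subSS in J1.
have [n2 [r3 [m3 [nT2 J2 R5]]]] := IH r2 m2 (ltnW klen) J1 w2.
exists (1 + (n1 + n2)), r3, m3; split=> //; last first.
  by apply: (runs_trans R3); apply: runs_trans R4 R5.
by rewrite mulSn -addnA; apply: (leq_add nT1 nT2).
Qed.

(** Registers from [d] upwards serve as an evaluation stack. Adding register 3, which holds 0, is a
    register copy. *)
Fixpoint compile (e : expr) (d : nat) : seq instr :=
  match e with
  | Cst n => [:: Const d n]
  | Order => [:: Add d 0 3]
  | Paschs => [:: Add d 8 3]
  | Mitres => [:: Add d 9 3]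
  | Plus e1 e2 => compile e1 d ++ compile e2 d.+1 ++ [:: Add d d d.+1]
  | Times e1 e2 => compile e1 d ++ compile e2 d.+1 ++ [:: Mul d d d.+1]
  end.

Lemma wp_cat N b1 b2 Q r m : wp N b1 (wp N b2 Q) r m -> wp N (b1 ++ b2) Q r m.
Proof.
elim: b1 r m => //= -[]; try by move=> a b b1 IH r m; try (move=> [? ?]; split => //); apply: IH.
- by move=> d x y b1 IH r m [? ?]; split=> //; apply: IH.
- by move=> d x y b1 IH r m ?; apply: IH.
- by move=> d x y b1 IH r m [? ?]; split=> //; apply: IH.
- by move=> d x y b1 IH r m ?; apply: IH.
by [].
Qed.

(** An exponent of v + 2 bounding the value when both counts are at most v^3. As the base is at
    least 2, it dominates a constant n by 2^n, and one extra factor pays for a sum. *)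
Fixpoint size_exp (e : expr) : nat :=
  match e with
  | Cst n => n
  | Order => 1
  | Paschs | Mitres => 3
  | Plus e1 e2 => (size_exp e1 + size_exp e2).+1
  | Times e1 e2 => size_exp e1 + size_exp e2
  end.

Lemma eval_bound v P M e : P <= v ^ 3 -> M <= v ^ 3 ->
  eval v P M e < v.+2 ^ size_exp e.
Proof.
move=> HP HM; have v3 : v ^ 3 < v.+2 ^ 3 by rewrite ltn_exp2r // leqW.
elim: e => /= [n|||||].
- by apply: leq_trans (ltn_expl n (ltnSn 1)) _; case: n => // n; rewrite leq_exp2r.
- by rewrite expn1 leqW.
- exact: leq_ltn_trans v3.
- exact: leq_ltn_trans v3.
- move=> e1 H1 e2 H2; rewrite expnS expnD.
  move: H1 H2; set x := eval _ _ _ _; set y := eval _ _ _ _.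
  set a := _ ^ _; set b := _ ^ size_exp e2; nia.
move=> e1 H1 e2 H2; rewrite expnD.
exact: ltn_mul.
Qed.

Lemma wp_compile N v P M e d r m (Q : assertion) :
  P <= v ^ 3 -> M <= v ^ 3 -> v.+2 ^ size_exp e <= N ->
  r 0 = v -> r 3 = 0 -> r 8 = P -> r 9 = M -> 9 < d ->
  (forall r', (forall j, j < d -> r' j = r j) -> r' d = eval v P M e -> Q r' m) ->
  wp N (compile e d) Q r m.
Proof.
move=> HP HM; elim: e d r Q => [n|||||] /=; last 2 first.
- move=> e1 IH1 e2 IH2 d r Q HN r0 r3 r8 r9 d9 HQ; have Hb := eval_bound (Plus e1 e2) HP HM.
  have [N1 N2] : v.+2 ^ size_exp e1 <= N /\ v.+2 ^ size_exp e2 <= N.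
    by split; apply: leq_trans HN; rewrite leq_exp2l //= leqW // ?leq_addr ?leq_addl.
  apply: wp_cat; apply: IH1 => // r1 L1 E1; apply: wp_cat.
  have L19 j : j <= 9 -> r1 j = r j by move=> j9; apply: L1; apply: leq_ltn_trans d9.
  apply: IH2 => //; rewrite ?L19 //; first exact: leqW.
  move=> r2 L2 E2 /=; rewrite E2 L2 // E1; split; first exact: leq_trans Hb HN.
  apply: HQ => [j jd|]; last by rewrite /update eqxx.
  by rewrite /update (ltn_eqF jd) L2 ?L1 // ltnW.
- move=> e1 IH1 e2 IH2 d r Q HN r0 r3 r8 r9 d9 HQ; have Hb := eval_bound (Times e1 e2) HP HM.
  have [N1 N2] : v.+2 ^ size_exp e1 <= N /\ v.+2 ^ size_exp e2 <= N.
    by split; apply: leq_trans HN; rewrite leq_exp2l //= ?leq_addr ?leq_addl.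
  apply: wp_cat; apply: IH1 => // r1 L1 E1; apply: wp_cat.
  have L19 j : j <= 9 -> r1 j = r j by move=> j9; apply: L1; apply: leq_ltn_trans d9.
  apply: IH2 => //; rewrite ?L19 //; first exact: leqW.
  move=> r2 L2 E2 /=; rewrite E2 L2 // E1; split; first exact: leq_trans Hb HN.
  apply: HQ => [j jd|]; last by rewrite /update eqxx.
  by rewrite /update (ltn_eqF jd) L2 ?L1 // ltnW.
- move=> d r Q HN r0 r3 r8 r9 d9 HQ; split; first exact: leq_trans (eval_bound (Cst n) HP HM) HN.
  by apply: HQ => [j jd|]; rewrite /update ?eqxx // (ltn_eqF jd).
- move=> d r Q HN r0 r3 r8 r9 d9 HQ; rewrite r0 r3 addn0; split.
    exact: leq_trans (eval_bound Order HP HM) HN.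
  by apply: HQ => [j jd|]; rewrite /update ?eqxx // (ltn_eqF jd).
- move=> d r Q HN r0 r3 r8 r9 d9 HQ; rewrite r8 r3 addn0; split.
    exact: leq_trans (eval_bound Paschs HP HM) HN.
  by apply: HQ => [j jd|]; rewrite /update ?eqxx // (ltn_eqF jd).
move=> d r Q HN r0 r3 r8 r9 d9 HQ; rewrite r9 r3 addn0; split.
  exact: leq_trans (eval_bound Mitres HP HM) HN.
by apply: HQ => [j jd|]; rewrite /update ?eqxx // (ltn_eqF jd).
Qed.

(** * The counting program *)

(* Registers: 0 holds v, 1 the number of lines, 2 and 3 the constants 1 and 0,
   4 the address of the multiplication table, 5 the loop counter, 6 and 7 hold
   v^2 and v^3, 8 and 9 the two counts; register 10 is scratch. *)
Definition put (x y z : nat) : seq instr :=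
  [:: Mul 10 x 0; Add 10 10 4; Add 10 10 y; Write 10 z].

Definition get (d x y : nat) : seq instr :=
  [:: Mul 10 x 0; Add 10 10 4; Add 10 10 y; Read d 10].

(* Adds 1 to register [d] if registers [x] and [y] agree: truncated
   subtraction gives [1 - (x - y) - (y - x) = (x == y)]. *)
Definition tally_eq (d x y : nat) : seq instr :=
  [:: Defs.Sub 10 x y; Defs.Sub 19 y x; Defs.Sub 10 2 10; Defs.Sub 10 10 19; Add d d 10].

Definition prog_init : code := block [:: Const 2 1; Const 10 3; Mul 4 10 1].

Definition prog_diagonal : code := loop 5 0 (block (put 5 5 5 ++ [:: Add 5 5 2])).

Definition prog_lines : code := loop 5 1 (block (
  [:: Add 10 5 5; Add 10 10 5; Read 11 10; Add 10 10 2; Read 12 10; Add 10 10 2; Read 13 10]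
  ++ put 11 12 13 ++ put 12 11 13 ++ put 11 13 12 ++ put 13 11 12
  ++ put 12 13 11 ++ put 13 12 11 ++ [:: Add 5 5 2])).

Definition prog_reset : code :=
  block [:: Mul 6 0 0; Mul 7 6 0; Const 8 0; Const 9 0].

(* The counter runs through v^3 and encodes the triple (a, b, d) in base v. *)
Definition prog_count : code := loop 5 7 (block (
  [:: Div 11 5 6; Mul 10 11 6; Defs.Sub 20 5 10; Div 12 20 0; Mul 10 12 0; Defs.Sub 13 20 10]
  ++ get 14 11 12 ++ get 15 11 13 ++ get 16 12 13 ++ get 17 14 15 ++ get 18 11 16
  ++ tally_eq 8 17 16 ++ tally_eq 9 17 18 ++ [:: Add 5 5 2])).

Definition prog_output (p q den : expr) : code := block (
  compile p 20 ++ compile q 21 ++ compile den 22 ++ [:: Defs.Sub 20 20 21; Div 0 20 22]).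

Definition counting_program (p q den : expr) : code :=
  seqc prog_init (seqc prog_diagonal (seqc prog_lines (seqc prog_reset
    (seqc prog_count (prog_output p q den))))).

(** * Sums over triples coded in base v *)

Lemma sum_divmod (m n : nat) (F : nat -> nat -> nat) :
  \sum_(0 <= t < m * n) F (t %/ n) (t %% n) =
  \sum_(0 <= i < m) \sum_(0 <= j < n) F i j.
Proof.
case: n => [|n]; first by rewrite muln0 !big_nil big1 // => i _; rewrite big_nil.
elim: m => [|m IH]; first by rewrite !big_nil.
rewrite [RHS]big_nat_recr //= -IH mulSn addnC (@big_cat_nat _ _ _ (m * n.+1)) ?leq_addr //=.
congr (_ + _); rewrite -{1}[m * n.+1]add0n big_addn addKn.
apply: eq_big_nat => j /andP[_ jn].
by rewrite addnC divnMDl // modnMDl divn_small // modn_small // addn0.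
Qed.

Lemma count3_sum (W : finType) (Q : W -> W -> W -> bool) :
  count3 Q = \sum_a \sum_b \sum_d Q a b d.
Proof.
rewrite /count3 -sum1_card pair_bigA pair_bigA /= big_mkcond /=.
by apply: eq_bigr => -[[a b] d] _; rewrite inE /=; case: (Q a b d).
Qed.

Lemma count3_ord v (Q : 'I_v -> 'I_v -> 'I_v -> bool) (T : nat -> nat -> nat -> bool) :
  (forall a b d : 'I_v, T a b d = Q a b d) ->
  count3 Q = \sum_(0 <= t < v * v * v)
    T (t %/ (v * v)) (t %% (v * v) %/ v) (t %% (v * v) %% v).
Proof.
move=> TQ; rewrite -mulnA.
rewrite (sum_divmod v (v * v) (fun a t => T a (t %/ v) (t %% v))) big_mkord count3_sum.
apply: eq_bigr => a _; rewrite (sum_divmod v v (fun b d => T a b d)) big_mkord.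
apply: eq_bigr => b _; rewrite big_mkord; apply: eq_bigr => d _.
by rewrite TQ.
Qed.

Lemma count3_le v (Q : 'I_v -> 'I_v -> 'I_v -> bool) : count3 Q <= v ^ 3.
Proof.
by apply: leq_trans (max_card _) _; rewrite !card_prod card_ord !expnS expn0 muln1 mulnA.
Qed.

Lemma input_nth v (s : seq ('I_v * 'I_v * 'I_v)) t0 k : k < size s ->
  let inp := mem_cells (initial_state s) in let t := nth t0 s k in
  [/\ inp (k + k + k) = t.1.1, inp (k + k + k + 1) = t.1.2 & inp (k + k + k + 1 + 1) = t.2].
Proof.
elim: s k => [|t s IH] [|k] //= ks; have [/= H1 H2 H3] := IH k ks.
by rewrite -H1 -H2 -H3 !addn1 !addnS ?addSn ?addnS.
Qed.

(** * Correctness and running time of the counting program *)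

Section Execution.

Variables (v : nat) (B : {set {set 'I_v}}) (s : seq ('I_v * 'I_v * 'I_v)) (N : nat).
Hypotheses (sts : steiner_triple_system B) (ls : lists_lines s B).
Hypothesis HN : v * v * v + v * v + v + 4 * size s + 10 < N.

Let b := size s.
Let op := line_op B.
Let inp := mem_cells (initial_state s).

Lemma mem_lines (t : 'I_v * 'I_v * 'I_v) : t \in s -> [set t.1.1; t.1.2; t.2] \in B.
Proof.
move=> ts; rewrite -mem_enum -(perm_mem ls).
exact: (map_f (fun x : 'I_v * 'I_v * 'I_v => [set x.1.1; x.1.2; x.2])).
Qed.

Lemma uniq_line (t : 'I_v * 'I_v * 'I_v) : t \in s -> uniq [:: t.1.1; t.1.2; t.2].
Proof.
move/mem_lines=> tB; apply/card_uniqP; rewrite /= -(proj1 sts _ tB).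
by apply: eq_card => x; rewrite !inE orbA.
Qed.

Lemma op_line (t : 'I_v * 'I_v * 'I_v) : t \in s ->
  op t.1.1 t.1.2 = t.2 /\ op t.1.1 t.2 = t.1.2 /\ op t.1.2 t.2 = t.1.1.
Proof.
move=> ts; have := uniq_line ts; have tB := mem_lines ts.
rewrite /= !inE negb_or andbT => /andP[/andP[ab ac] bc].
have E : op t.1.1 t.1.2 = t.2.
  by apply/eqP; rewrite line_opE // ![t.2 == _]eq_sym ac bc.
have [_ C K] := line_op_squag sts; rewrite -/op in C K.
by split=> //; split; rewrite -E ?K // (C t.1.1) K.
Qed.

Lemma line_through (x y : 'I_v) : x != y ->
  exists2 t, t \in s & (x \in [:: t.1.1; t.1.2; t.2]) && (y \in [:: t.1.1; t.1.2; t.2]).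
Proof.
move=> xy; have := eqxx (op x y); rewrite line_opE // => /and3P[_ _].
rewrite -mem_enum -(perm_mem ls) => /mapP[t ts E]; exists t => //.
have /setP/(_ x) := E; have /setP/(_ y) := E; rewrite !inE !eqxx !orbT /=.
by rewrite !orbA => <- <-.
Qed.

(** Distinct lines come from distinct triples; this crude cubic bound suffices for the running
    time. *)
Lemma size_lines : b <= v * v * v.
Proof.
have us : uniq s by apply: (@map_uniq _ _ (fun x => [set x.1.1; x.1.2; x.2]));
  rewrite (perm_uniq ls) enum_uniq.
by rewrite /b -(card_uniqP us) (leq_trans (max_card _)) // !card_prod card_ord.
Qed.

(** A row-major table placed directly behind the 3b input cells. *)
Definition cell (x y : nat) : nat := x * v + 3 * b + y.

Lemma cell_inj x y x' y' : y < v -> y' < v -> cell x y = cell x' y' -> x = x' /\ y = y'.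
Proof.
move=> yv yv'; rewrite /cell addnAC [RHS]addnAC => /addIn E.
have v0 : 0 < v by apply: leq_ltn_trans yv.
have := congr1 (divn^~ v) E; rewrite !divnMDl // !divn_small // !addn0 => Ex.
by split=> //; move: E; rewrite Ex => /addnI.
Qed.

Lemma cell_bound x y : x < v -> y < v -> cell x y < N.
Proof. by move=> xv yv; rewrite /cell; move: HN; rewrite -/b; nia. Qed.

Definition base_regs (r : nat -> nat) : Prop :=
  [/\ r 0 = v, r 1 = b, r 2 = 1, r 3 = 0 & r 4 = 3 * b].

Lemma eq_base_regs r r' : (forall j, j < 5 -> r' j = r j) -> base_regs r -> base_regs r'.
Proof. by move=> E [*]; split; rewrite E. Qed.

Lemma wp_put x y z rest Q r m : x != 10 -> y != 10 -> z != 10 ->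
  base_regs r -> r x < v -> r y < v ->
  (forall r', (forall j, j != 10 -> r' j = r j) ->
     wp N rest Q r' (update m (cell (r x) (r y)) (r z))) ->
  wp N (put x y z ++ rest) Q r m.
Proof.
move=> nx ny nz [r0 _ _ _ r4] xv yv H /=.
have cb := cell_bound xv yv; rewrite /cell in cb.
rewrite /update /= (negPf ny) (negPf nz) r0 r4.
split; first by lia. split; first by lia. split=> //.
rewrite -/(update m _ _); apply: H => j nj.
by rewrite (negPf nj).
Qed.

Lemma wp_get d x y rest Q r m : y != 10 ->
  base_regs r -> r x < v -> r y < v ->
  (forall r', (forall j, j != 10 -> j != d -> r' j = r j) ->
     r' d = m (cell (r x) (r y)) -> wp N rest Q r' m) ->
  wp N (get d x y ++ rest) Q r m.
Proof.
move=> ny [r0 _ _ _ r4] xv yv H /=.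
have cb := cell_bound xv yv; rewrite /cell in cb.
rewrite /update /= (negPf ny) r0 r4.
split; first by lia. split; first by lia. split=> //.
apply: H => [j nj nd|]; last by rewrite eqxx.
by rewrite (negPf nj) (negPf nd).
Qed.

Lemma wp_tally_eq d x y rest Q r m :
  [&& d != 10, x != 10, y != 10, d != 19, x != 19, y != 19 & d != 2] ->
  base_regs r -> (r d).+1 < N ->
  (forall r', (forall j, j != 10 -> j != 19 -> j != d -> r' j = r j) ->
     r' d = r d + (r x == r y) -> wp N rest Q r' m) ->
  wp N (tally_eq d x y ++ rest) Q r m.
Proof.
have sub_eq i j : 1 - (i - j) - (j - i) = (i == j) by case: ltngtP; lia.
move=> /and5P[/negPf d10 /negPf x10 /negPf y10 /negPf d19].
move=> /and3P[/negPf x19 /negPf y19 /negPf d2] [_ _ r2 _ _] dN H /=.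
rewrite /update /= d10 d19 x10 y10 r2 sub_eq; split.
  by apply: leq_ltn_trans dN; rewrite -addn1 leq_add2l leq_b1.
apply: H => [j /negPf j10 /negPf j19 /negPf jd|]; first by rewrite jd j10 j19.
by rewrite eqxx.
Qed.

(** [S] is the set of entries filled so far. The input cells must survive, since the lines are read
    while the table is being written. *)
Definition table_on (S : 'I_v -> 'I_v -> Prop) (m : nat -> nat) : Prop :=
  (forall j, j < 3 * b -> m j = inp j) /\
  (forall x y : 'I_v, S x y -> m (cell x y) = op x y).

Lemma table_on_sub (S S' : 'I_v -> 'I_v -> Prop) m :
  (forall x y, S' x y -> S x y) -> table_on S m -> table_on S' m.
Proof. by move=> H [Hi Ht]; split=> // x y /H; apply: Ht. Qed.

Lemma table_on_put S m (x y z : 'I_v) : table_on S m -> op x y = z ->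
  table_on (fun x' y' => S x' y' \/ (x' = x /\ y' = y)) (update m (cell x y) z).
Proof.
move=> [Hi Ht] <-; split=> [j jb|x' y' Sxy].
  rewrite /update ifN; first exact: Hi.
  by rewrite neq_ltn; apply/orP; left; rewrite /cell; lia.
rewrite /update; case: eqP => [/cell_inj [] // /val_inj -> /val_inj -> //|ne].
by case: Sxy => [|[E1 E2]]; [apply: Ht | case: ne; rewrite E1 E2].
Qed.

Lemma triple_init :
  triple N 3 (fun r m => r = regs (initial_state s) /\ m = inp) prog_init
    (fun r m => base_regs r /\ table_on (fun _ _ => False) m).
Proof.
apply: triple_wp => // r m [-> ->] /=.
by rewrite /update /=; move: HN; rewrite -/b => HN'; split; [lia|split; [lia|split; [lia|]]].
Qed.

Lemma triple_diagonal :
  triple N (v * 6 + 3) (fun r m => base_regs r /\ table_on (fun _ _ => False) m)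
    prog_diagonal (fun r m => base_regs r /\ table_on (fun x y => x = y) m).
Proof.
pose J k (r m : nat -> nat) :=
  [/\ base_regs r, r 5 = k & table_on (fun x y => x = y /\ x < k) m].
apply: (@triple_post N _ _ (J v)).
  move=> r m [br _ tm]; split=> //; apply: table_on_sub tm => x y ->; split=> //.
apply: triple_loop.
- move=> r m [br tm]; have [_ _ r2 r3 _] := br; rewrite /update /= r2 r3; split=> //.
  by split=> //; apply: table_on_sub tm => x y [_ /=].
- by move=> k r m [[r0 _ _ _ _] r5 _].
move=> k kv; apply: triple_wp => // r m [br r5 tm].
apply: wp_put; rewrite ?r5 // => r' E /=.
have br' : base_regs r'.
  by apply: eq_base_regs br => j j5; apply: E; rewrite ltn_eqF // (ltn_trans j5).
have [_ _ r2 _ _] := br'; rewrite E // r5 r2 addn1; split; first by move: HN; lia.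
split=> //; apply: (table_on_sub _ (@table_on_put _ _ (Ordinal kv) (Ordinal kv) (Ordinal kv) tm _)).
  move=> x y [-> /=]; rewrite ltnS leq_eqVlt => /orP[/eqP E'|yk]; last by left.
  by right; split; apply: val_inj.
by case: (line_op_squag sts).
Qed.

Definition on_lines k (x y : 'I_v) : Prop := x = y \/
  exists2 t, t \in take k s & (x \in [:: t.1.1; t.1.2; t.2]) && (y \in [:: t.1.1; t.1.2; t.2]).

(** The body has 7 + 6 * 4 + 1 = 32 instructions, and the loop test makes 33. *)
Lemma triple_lines :
  triple N (b * 33 + 3) (fun r m => base_regs r /\ table_on (fun x y => x = y) m)
    prog_lines (fun r m => base_regs r /\ table_on (fun _ _ => True) m).
Proof.
pose J k (r m : nat -> nat) := [/\ base_regs r, r 5 = k & table_on (on_lines k) m].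
apply: (@triple_post N _ _ (J b)).
  move=> r m [br _ tm]; split=> //; apply: table_on_sub tm => x y _.
  have [->|xy] := eqVneq x y; [by left | right].
  by rewrite take_size; apply: line_through.
apply: triple_loop.
- move=> r m [br tm]; have [_ _ r2 r3 _] := br; rewrite /update /= r2 r3; split=> //.
  by split=> //; apply: table_on_sub tm => x y [//|[t]]; rewrite take0.
- by move=> k r m [[_ r1 _ _ _] r5 _].
move=> k kb; apply: triple_wp.
  by [].
move=> r m [br r5 tm].
have [t0 _] : exists t0, t0 \in s.
  by case: (s) (kb : k < size s) => // t s' _; exists t; apply: mem_head.
have [] := input_nth t0 kb; set t := nth t0 s k; rewrite -/inp => i1 i2 i3.
have ts : t \in s by apply: mem_nth.
apply: wp_cat; set rest := put 11 12 13 ++ _; set Q := J k.+1.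
suff H r' : (forall j, j < 10 -> r' j = r j) ->
    r' 11 = t.1.1 -> r' 12 = t.1.2 -> r' 13 = t.2 -> wp N rest Q r' m.
  clearbody rest Q; have [_ _ r2 _ _] := br; have [tmi _] := tm; rewrite /= /update /= r5 r2.
  do 4!(split; first by move: HN kb; rewrite -/b; lia).
  apply: H => [j j10|||] /=.
  - by rewrite !ifN // ltn_eqF // (ltn_trans j10).
  - by rewrite tmi ?i1 //; move: kb; rewrite -/b; lia.
  - by rewrite tmi ?i2 //; move: kb; rewrite -/b; lia.
  by rewrite tmi ?i3 //; move: kb; rewrite -/b; lia.
move=> E e11 e12 e13.
pose F (r1 : nat -> nat) := [/\ base_regs r1, r1 5 = k, r1 11 = t.1.1, r1 12 = t.1.2 & r1 13 = t.2].
have F' : F r'.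
  by split=> //; rewrite ?E //; apply: eq_base_regs br => j j5; rewrite E // (ltn_trans j5).
have put_step (x y z : nat) (X Y Z : 'I_v) rest' S (r1 m1 : nat -> nat) :
    x != 10 -> y != 10 -> z != 10 -> r1 x = X -> r1 y = Y -> r1 z = Z -> op X Y = Z ->
    F r1 -> table_on S m1 ->
    (forall r2 m2, F r2 ->
       table_on (fun x' y' => S x' y' \/ (x' = X /\ y' = Y)) m2 -> wp N rest' Q r2 m2) ->
    wp N (put x y z ++ rest') Q r1 m1.
  move=> nx ny nz rx ry rz XYZ F1 T1 H; have [br1 a5 a11 a12 a13] := F1.
  apply: wp_put; rewrite ?rx ?ry // => r2 E2; apply: H; last first.
    by rewrite rz; apply: table_on_put.
  split; rewrite ?E2 //; apply: eq_base_regs br1 => j j5.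
  by rewrite E2 // ltn_eqF // (ltn_trans j5).
have [o1 [o2 o3]] := op_line ts; have [_ C _] := line_op_squag sts; rewrite -/op in C.
rewrite /rest; case: (F') => _ _ a1 a2 a3.
apply: (put_step 11 12 13 _ _ _ _ _ _ _ isT isT isT a1 a2 a3 o1 F' tm) => r1 m1 F1 T1.
case: (F1) => _ _ {}a1 {}a2 {}a3.
apply: (put_step 12 11 13 _ _ _ _ _ _ _ isT isT isT a2 a1 a3 (etrans (C _ _) o1) F1 T1).
move=> r2 m2 F2 T2.
case: (F2) => _ _ {}a1 {}a2 {}a3.
apply: (put_step 11 13 12 _ _ _ _ _ _ _ isT isT isT a1 a3 a2 o2 F2 T2) => r3 m3 F3 T3.
case: (F3) => _ _ {}a1 {}a2 {}a3.
apply: (put_step 13 11 12 _ _ _ _ _ _ _ isT isT isT a3 a1 a2 (etrans (C _ _) o2) F3 T3).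
move=> r4 m4 F4 T4.
case: (F4) => _ _ {}a1 {}a2 {}a3.
apply: (put_step 12 13 11 _ _ _ _ _ _ _ isT isT isT a2 a3 a1 o3 F4 T4) => r6 m6 F6 T6.
case: (F6) => _ _ {}a1 {}a2 {}a3.
apply: (put_step 13 12 11 _ _ _ _ _ _ _ isT isT isT a3 a2 a1 (etrans (C _ _) o3) F6 T6).
move=> r7 m7 [br7 e5 _ _ _] T7 /=; have [_ _ r2' _ _] := br7.
rewrite e5 r2' addn1; split; first by move: HN kb; lia.
split=> //; apply: table_on_sub T7 => x y [->|[t']]; first by rewrite /on_lines; intuition.
rewrite (take_nth t0) // -/t mem_rcons inE => /orP[/eqP ->|tk xy].
  (* Of the nine pairs on the new line three are diagonal and six have just been stored. *)
  by rewrite /on_lines !inE => /andP[/or3P[]/eqP -> /or3P[]/eqP ->]; intuition.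
by do 6!left; right; exists t'.
Qed.

(** * Counting triples with the finished table held fixed *)

Section Count.

Variable m0 : nat -> nat.
Hypothesis tab_m0 : forall x y : 'I_v, m0 (cell x y) = op x y.

Let tab x y := m0 (cell x y).

Definition tab_pasch a b d : bool := tab (tab a b) (tab a d) == tab b d.
Definition tab_mitre a b d : bool := tab (tab a b) (tab a d) == tab a (tab b d).

Definition at_code (T : nat -> nat -> nat -> bool) (t : nat) : bool :=
  T (t %/ (v * v)) (t %% (v * v) %/ v) (t %% (v * v) %% v).

Lemma count3_pasch :
  count3 (pasch_eq op) = \sum_(0 <= t < v * v * v) at_code tab_pasch t.
Proof. by apply: count3_ord => a c d; rewrite /tab_pasch /tab !tab_m0. Qed.

Lemma count3_mitre :
  count3 (mitre_eq op) = \sum_(0 <= t < v * v * v) at_code tab_mitre t.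
Proof. by apply: count3_ord => a c d; rewrite /tab_mitre /tab !tab_m0. Qed.

Lemma tab_lt x y : x < v -> y < v -> tab x y < v.
Proof.
by move=> xv yv; rewrite /tab (tab_m0 (Ordinal xv) (Ordinal yv)) ltn_ord.
Qed.

Lemma sum_bool_le (T : nat -> bool) k : \sum_(0 <= t < k) T t <= k.
Proof.
rewrite -[X in _ <= X]muln1 -[X in _ <= X * _]subn0 -sum_nat_const_nat.
by apply: leq_sum => i _; case: (T i).
Qed.

Definition counting k (r m : nat -> nat) : Prop :=
  [/\ base_regs r, m = m0, [/\ r 5 = k, r 6 = v * v & r 7 = v * v * v],
      r 8 = \sum_(0 <= t < k) at_code tab_pasch t
    & r 9 = \sum_(0 <= t < k) at_code tab_mitre t].

Lemma triple_reset :
  triple N 4 (fun r m => base_regs r /\ m = m0) prog_reset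
    (fun r m => [/\ base_regs r, m = m0, r 6 = v * v, r 7 = v * v * v & r 8 = 0 /\ r 9 = 0]).
Proof.
apply: triple_wp => // r m [br ->] /=; have [r0 _ _ _ _] := br.
rewrite /update /= r0; split; first by move: HN; lia.
split; first by move: HN; lia.
by split; [move: HN; lia | split; [move: HN; lia|]].
Qed.

(** The body has 6 + 5 * 4 + 2 * 5 + 1 = 37 instructions; with the test this is rounded up to 40. *)
Lemma triple_count :
  triple N (v * v * v * 40 + 3)
    (fun r m => [/\ base_regs r, m = m0, r 6 = v * v, r 7 = v * v * v & r 8 = 0 /\ r 9 = 0])
    prog_count (counting (v * v * v)).
Proof.
apply: triple_loop.
- move=> r m [br -> r6 r7 [r8 r9]]; have [_ _ r2 r3 _] := br.
  by rewrite /update /= r2 r3 /counting !big_nil.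
- by move=> k r m [_ _ [-> _ ->]].
move=> k kv; apply: triple_wp.
  by [].
move=> r m [br -> [r5 r6 r7] r8 r9].
apply: wp_cat; set rest := get 14 11 12 ++ _; set Q := counting k.+1.
pose a := k %/ (v * v); pose c := k %% (v * v) %/ v; pose d := k %% (v * v) %% v.
have v0 : 0 < v by move: kv; case: (v).
have av : a < v by rewrite ltn_divLR ?muln_gt0 ?v0 // mulnA.
have cv : c < v by rewrite ltn_divLR // ltn_pmod // muln_gt0 v0.
have dv : d < v by rewrite ltn_pmod.
have modE x y : x - x %/ y * y = x %% y by rewrite {1}(divn_eq x y) addKn.
suff H r' : (forall j, j < 10 -> r' j = r j) -> r' 11 = a -> r' 12 = c -> r' 13 = d ->
    wp N rest Q r' m0.
  clearbody rest Q; have [r0 _ _ _ _] := br; rewrite /= /update /= r5 r6 r0 !modE.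
  split; first by apply: leq_ltn_trans (leq_trunc_div _ _) _; move: HN; lia.
  split; first by apply: leq_ltn_trans (leq_trunc_div _ _) _;
    apply: leq_ltn_trans (leq_mod _ _) _; move: HN; lia.
  by apply: H => // j j10; rewrite /= !ifN // ltn_eqF // (ltn_trans j10).
move=> E e11 e12 e13.
pose G (r1 : nat -> nat) :=
  [/\ forall j, j < 10 -> r1 j = r j, r1 11 = a, r1 12 = c & r1 13 = d].
have Gb r1 : G r1 -> base_regs r1.
  by case=> E1 _ _ _; apply: eq_base_regs br => j j5; rewrite E1 // (ltn_trans j5).
have Gs e r1 r2 : 13 < e -> G r1 ->
    (forall j, j != 10 -> j != e -> r2 j = r1 j) -> G r2.
  move=> e13' [E1 f1 f2 f3] E2.
  have ne j : j < 14 -> j != e by move=> j14; rewrite neq_ltn (leq_trans j14 e13').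
  split=> [j j10|||]; [| by rewrite E2 // ne ..].
  by rewrite E2 ?E1 ?ne ?neq_ltn ?j10 // (ltn_trans j10).
have G0 : G r' by [].
have get_step (e x y X Y : nat) rest' (r1 : nat -> nat) :
    13 < e -> y != 10 -> G r1 -> r1 x = X -> r1 y = Y -> X < v -> Y < v ->
    (forall r2, G r2 -> (forall j, j != 10 -> j != e -> r2 j = r1 j) ->
       r2 e = tab X Y -> wp N rest' Q r2 m0) ->
    wp N (get e x y ++ rest') Q r1 m0.
  move=> e13' ny G1 <- <- Xv Yv H; apply: wp_get; [exact: ny|exact: Gb|exact: Xv|exact: Yv|].
  by move=> r2 E2 Ee; apply: H; [apply: Gs E2|exact: E2|exact: Ee].
apply: (get_step 14 11 12 _ _ _ _ isT isT G0 e11 e12 av cv) => r1 G1 E1 e14.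
have [_ f1 f2 f3] := G1.
apply: (get_step 15 11 13 _ _ _ _ isT isT G1 f1 f3 av dv) => r2 G2 E2 e15.
have [_ {}f1 {}f2 {}f3] := G2; have {}e14 := etrans (E2 14 isT isT) e14.
apply: (get_step 16 12 13 _ _ _ _ isT isT G2 f2 f3 cv dv) => r3 G3 E3 e16.
have [_ {}f1 {}f2 {}f3] := G3; have {}e14 := etrans (E3 14 isT isT) e14.
have {}e15 := etrans (E3 15 isT isT) e15.
apply: (get_step 17 14 15 _ _ _ _ isT isT G3 e14 e15 (tab_lt av cv) (tab_lt av dv)).
move=> r4 G4 E4 e17.
have [_ {}f1 {}f2 {}f3] := G4; have {}e16 := etrans (E4 16 isT isT) e16.
apply: (get_step 18 11 16 _ _ _ _ isT isT G4 f1 e16 av (tab_lt cv dv)) => r10 G10 E10 e18.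
have [L10 _ _ _] := G10; have {}e16 := etrans (E10 16 isT isT) e16.
have {}e17 := etrans (E10 17 isT isT) e17.
have pk := sum_bool_le (at_code tab_pasch) k.
have mk := sum_bool_le (at_code tab_mitre) k.
apply: wp_tally_eq; [by []|exact: Gb| |].
  by rewrite L10 // r8; apply: leq_ltn_trans HN; lia.
rewrite e16 e17 L10; last by []; move=> r11 E11 e8.
apply: wp_tally_eq; [by []| | |].
- by apply: eq_base_regs (Gb _ G10) => j j5; rewrite E11 // neq_ltn (ltn_trans j5).
- by rewrite E11 // L10 // r9; apply: leq_ltn_trans HN; lia.
rewrite !E11 // e17 e18 L10; last by []; move=> r12 E12 e9 /=.
have L12 j : j < 8 -> r12 j = r j.
  move=> j8; have ne i : 7 < i -> j != i by move=> i8; rewrite neq_ltn (leq_trans j8 i8).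
  by rewrite E12 ?ne // E11 ?ne // L10 // (ltn_trans j8).
have [_ _ b2 _ _] := br; rewrite !L12 // b2 r5 addn1; split; first by move: HN; lia.
rewrite /Q /counting /update /= !big_nat_recr //=; split=> //.
- by apply: eq_base_regs br => j j5; rewrite ltn_eqF // L12 // (ltn_trans j5).
- by rewrite !L12.
- by rewrite E12 // e8 r8.
by rewrite e9 r9.
Qed.

End Count.

Lemma triple_output P M p q den : P <= v ^ 3 -> M <= v ^ 3 ->
  v.+2 ^ size_exp p <= N -> v.+2 ^ size_exp q <= N -> v.+2 ^ size_exp den <= N ->
  triple N (size (prog_output p q den 0))
    (fun r m => [/\ base_regs r, r 8 = P & r 9 = M]) (prog_output p q den)
    (fun r m => r 0 = (eval v P M p - eval v P M q) %/ eval v P M den).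
Proof.
move=> HP HM Np Nq Nd; apply: triple_wp => // r m [[r0 _ _ r3 _] r8 r9].
apply: wp_cat; apply: (wp_compile HP HM) => // r1 E1 e1.
apply: wp_cat; apply: (wp_compile HP HM); rewrite ?E1 // => r2 E2 e2.
apply: wp_cat; apply: (wp_compile HP HM); rewrite ?E2 ?E1 // => r4 E4 e4 /=.
by rewrite /update /= e4 !E4 // e2 E2 // e1.
Qed.

Lemma initial_below : words_below N (initial_state s).
Proof.
have N0 : 0 < N by apply: leq_ltn_trans HN.
split=> i /=.
  by case: i => [|[|i]] /=; rewrite ?nth_nil //; move: HN; lia.
have [isz|isz] := leqP (size (flatten [seq [:: val x.1.1; val x.1.2; val x.2] | x <- s])) i.
  by rewrite nth_default.
have /flatten_mapP[t _] := mem_nth 0 isz.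
have vN (x : 'I_v) : x < N by apply: ltn_trans (ltn_ord x) _; move: HN; lia.
by rewrite !inE => /or3P[]/eqP ->; apply: vN.
Qed.

(** The coefficient 79 = 6 + 33 + 40 adds the three loops, with v and the number of lines bounded by
    v^3; 16 collects the initialisation, the reset and three steps per loop. *)
Lemma run_counting_program p q den :
  let ev := eval v (count3 (pasch_eq op)) (count3 (mitre_eq op)) in
  let prog := counting_program p q den 0 in
  v.+2 ^ size_exp p <= N -> v.+2 ^ size_exp q <= N -> v.+2 ^ size_exp den <= N ->
  exists n, [/\ n <= 79 * v ^ 3 + (16 + size (prog_output p q den 0)),
    halted prog (iter n (step prog) (initial_state s)),
    regs (iter n (step prog) (initial_state s)) 0 = (ev p - ev q) %/ ev den
    & forall k, k <= n -> words_below N (iter k (step prog) (initial_state s))].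
Proof.
move=> ev prog Np Nq Nd; set c0 := size _.
have tail : triple N (4 + ((v * v * v * 40 + 3) + c0))
    (fun r m => base_regs r /\ table_on (fun _ _ => True) m)
    (seqc prog_reset (seqc prog_count (prog_output p q den)))
    (fun r m => r 0 = (ev p - ev q) %/ ev den).
  (* The triple is unfolded to name the current memory, which the counting phase then treats as a
     constant table. *)
  move=> pre post r m w [br [_ tm]].
  have tab x y := tm x y I.
  have T3 := triple_output (count3_le (pasch_eq op)) (count3_le (mitre_eq op)) Np Nq Nd.
  have T2 : triple N (v * v * v * 40 + 3)
      (fun r m' => [/\ base_regs r, m' = m, r 6 = v * v, r 7 = v * v * v & r 8 = 0 /\ r 9 = 0])
      prog_count
      (fun r _ => [/\ base_regs r, r 8 = count3 (pasch_eq op) & r 9 = count3 (mitre_eq op)]).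
    apply: triple_post (triple_count tab) => r' m' [br' _ _ r8 r9].
    by rewrite (count3_pasch tab) (count3_mitre tab).
  have T := triple_seq (@triple_reset m) (triple_seq T2 T3).
  exact: (T pre post r m w (conj br erefl)).
have all := triple_seq triple_init (triple_seq triple_diagonal (triple_seq triple_lines tail)).
have := all [::] [::] (regs (initial_state s)) inp initial_below (conj erefl erefl).
rewrite /= cats0 add0n => -[n [r [m [nT r0 [E W]]]]].
exists n; rewrite /prog /counting_program.
split; last exact: W.
- apply: leq_trans nT _; have := size_lines; rewrite !expnS expn0 muln1 => hb.
  have : v <= v * (v * v) by case: (v) => // u; rewrite leq_pmulr.
  by move: hb; rewrite mulnA; lia.
- by rewrite /halted E.
by rewrite E.
Qed.

End Execution.

(** Order 0 is the one order at which the denominator can vanish; a nonempty type has no map into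
    the empty one. *)
Lemma occurrences_ord0 (V : finType) (C : {set {set V}}) (B : {set {set 'I_0}}) (x : V) :
  occurrences C B = 0.
Proof.
apply/eqP; rewrite cards_eq0; apply/eqP/setP=> D; rewrite !inE.
by apply/negP => /andP[_ /existsP[f _]]; case: (f x).
Qed.

Theorem theorem5 (V : finType) (C : {set {set V}}) :
  configuration C -> #|C| = 5 -> variable_configuration C ->
  computable_in_time (fun (v : nat) (B : {set {set 'I_v}}) => occurrences C B)
    (fun v : nat => v ^ 3).
Proof.
move=> [B0 [[B3 _] /subsetP CB0]] C5 _.
have C3 l : l \in C -> #|l| = 3 by move/CB0/B3.
have [d [K [p [q [d0 H]]]]] := occurrences_formula C3 C5.
pose den := Times (Power Order K) (Cst d).
pose c0 := 16 + size (prog_output p q den 0).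
exists (counting_program p q den 0), (6 + size_exp p + size_exp q + size_exp den).
exists (fun v => 79 * v ^ 3 + c0); split.
  exists (79 + c0), 1 => v v0; rewrite mulnDl leq_add2l leq_pmulr //.
  by rewrite expn_gt0 v0.
move=> v B s sts ls; set N := v.+2 ^ _.
have NE e : e <= 6 + size_exp p + size_exp q + size_exp den -> v.+2 ^ e <= N.
  by move=> ?; rewrite leq_exp2l.
(* This is where the 6 in the exponent is spent: with c = (v+2)^3 >= 8, the left side is below 8c <=
   c * c. *)
have HN : v * v * v + v * v + v + 4 * size s + 10 < N.
  apply: leq_trans (NE 6 _); last by rewrite -!addnA leq_addr.
  have hb := size_lines ls; rewrite !expnS expn0 muln1.
  set c := v.+2 * (v.+2 * v.+2).
  have -> : v.+2 * (v.+2 * (v.+2 * (v.+2 * (v.+2 * v.+2)))) = c * c by rewrite /c !mulnA.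
  have c8 : 8 <= c by rewrite /c; nia.
  have cE : c = v * v * v + 6 * (v * v) + 12 * v + 8 by rewrite /c; nia.
  by apply: leq_trans (leq_mul c8 (leqnn c)); rewrite cE; lia.
have [|||n [nT hn rn wn]] := run_counting_program (p := p) (q := q) (den := den) sts ls HN.
- by apply: NE; lia.
- by apply: NE; lia.
- by apply: NE; lia.
exists n; split=> //; rewrite rn -H // addnK /= eval_Power /=.
(* Since [d] is positive, a zero denominator means v = 0, where the quotient and the count are both
   0. *)
have [den0|den_gt0] := posnP (v ^ K * d); last by rewrite mulKn.
have v0 : v = 0.
  by move/eqP: den0; rewrite muln_eq0 expn_eq0 (gtn_eqF d0) orbF => /andP[/eqP].
have [x _] : exists x, x \in cover C by apply: cover_neq0; rewrite ?C5.
clear - x v0; subst v; by rewrite occurrences_ord0 // muln0 div0n.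
Qed.
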